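(* Assume the location-scale assumption holds and the losses $\ell(z,\eta)$ have lighter-than-Gaussian tails. Let $\mathbb{Q}_N$ and its fitting procedure satisfy Properties 1, 2 and 3. Then $$\mathbb{E}\big[\rho_{\hat{\mathbb{P}}_N}(\ell(z,\eta))+\delta_N(\mathbb{Q}_N)\big]-\rho_{\mathbb{P}}(\ell(z,\eta))=\Omega\big(\mathrm{Var}(\ell(z,\eta))\big).$$ If $\mathbb{Q}_N$ additionally satisfies Property 4, then $$\Big|\rho_{\mathbb{P}}(\ell(z,\eta))-\mathbb{E}\big[\rho_{\hat{\mathbb{P}}_N}(\ell(z,\eta))+\delta_N(\mathbb{Q}_N)\big]\Big|=\mathcal{O}\big(\mathrm{Var}(\ell(z,\eta))\big),$$ and $\rho_{\hat{\mathbb{P}}_N}(\ell(z,\eta))+\delta_N(\mathbb{Q}_N)$ is strongly asymptotically consistent, i.e. it converges almost surely to $\rho_{\mathbb{P}}(\ell(z,\eta))$ as $N\to\infty$.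
   Context: Fix $\alpha>0$. $\mathcal{Z}\subseteq\mathbb{R}^d$ is a set of decisions, $\eta$ is a random vector with law $\mathbb{P}$, and $\ell(z,\eta)$ is a real random loss for each $z\in\mathcal{Z}$. For a distribution $\mathbb{Q}$, $\rho_{\mathbb{Q}}(X)=\frac1\alpha\log\mathbb{E}_{\mathbb{Q}}[\exp(\alpha X)]\in(-\infty,\infty]$ is the entropic risk. $\hat{\mathbb{P}}_N$ is the empirical distribution of i.i.d. samples $\hat\eta_1,\dots,\hat\eta_N$ from $\mathbb{P}$; $\mathbb{E}$ in the claim is over the samples. Location-scale assumption: there are a fixed real random variable $\xi$ with $\mathbb{E}[\xi]=0$, $\mathbb{E}[\xi^2]=1$ and a set $\mathcal{A}\subset\mathbb{R}\times\mathbb{R}_+$ such that the set of distributions of $\{\ell(z,\eta):z\in\mathcal{Z}\}$ equals the set of distributions of $\{\mu+\sigma\xi:(\mu,\sigma)\in\mathcal{A}\}$. $X$ has lighter-than-Gaussian tails if there are $q>2$ and $G,C>0$ with $\mathbb{P}(|X|\ge a)\le G\exp(-Ca^q)$ for all $a\ge0$. A fitting procedure maps the scenarios $\{\ell(z,\hat\eta_i)\}_{i=1}^N$ to a probability distribution $\mathbb{Q}_N$ on $\mathbb{R}$; write $\zeta\sim\mathbb{Q}_N$. Given $\mathbb{Q}_N$, $\hat{\mathbb{Q}}_{N,N}$ is the empirical distribution of $N$ i.i.d. draws from $\mathbb{Q}_N$, and $\delta_N(\mathbb{Q}_N):=\mathrm{median}(\rho_{\mathbb{Q}_N}(\zeta)-\rho_{\hat{\mathbb{Q}}_{N,N}}(\zeta)\,|\,\mathbb{Q}_N)$,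 the median being over the draws producing $\hat{\mathbb{Q}}_{N,N}$. Let $\hat\mu_N$ and $\hat\sigma_N$ be the mean and standard deviation of $\ell(z,\eta)$ under $\hat{\mathbb{P}}_N$ (with $\hat\sigma_N>0$ almost surely, so that the standardizations below make sense). $\stackrel{F}{=}$ is equality in distribution. Property 1 (affine equivariance): for all $(a,b)\in\mathbb{R}\times\mathbb{R}_+$, if $\zeta\sim\mathbb{Q}_N$ is fitted on $\{\ell(z,\hat\eta_i)\}_{i=1}^N$ and $\zeta'\sim\mathbb{Q}_N'$ is fitted on $\{a+b\,\ell(z,\hat\eta_i)\}_{i=1}^N$, then $a+b\zeta\stackrel{F}{=}\zeta'$. Property 2 (mean matching): with probability one, $\mathbb{E}_{\mathbb{Q}_N}[\zeta]=\hat\mu_N$. Property 3 (uniformly heavy Gaussian right tails): there exist $\mathfrak{c}_1,\mathfrak{c}_2,\bar a>0$ (not depending on the sample or on $N$) such that with probability one $\mathbb{P}_{\mathbb{Q}_N}((\zeta-\hat\mu_N)/\hat\sigma_N\ge a)\ge\mathfrak{c}_1\exp(-a^2/\mathfrak{c}_2^2)$ for all $a\ge\bar a$. Property 4 (uniformly subgaussian tails): there exists $\mathfrak{c}_3>0$ (not depending on the sample or on $N$) such that with probability one $\mathbb{P}_{\mathbb{Q}_N}(|\zeta-\hat\mu_N|/\hat\sigma_N\ge a)\le2\exp(-a^2/\mathfrak{c}_3^2)$ for all $a\ge0$. Asymptotic notation: $\alpha$, $N$, the fitting procedure and the law of $\xi$ are fixed, and quantities are considered as $\sigma=\sqrt{\mathrm{Var}(\ell(z,\eta))}$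 varies. $f=\mathcal{O}(g(\sigma))$: there are $c,\bar\sigma>0$ with $f\le c\,g(\sigma)$ whenever $\sigma\ge\bar\sigma$. $f=\Omega(g(\sigma))$: there are $c,\bar\sigma>0$ with $c\,g(\sigma)\le f$ whenever $\sigma\ge\bar\sigma$. The consistency statement is for a fixed decision $z$ as $N\to\infty$. *)

(* Defs.v *)
From HB Require Import structures.
From mathcomp Require Import all_boot all_order all_algebra.
From mathcomp Require Import finmap.
From mathcomp Require Import all_classical all_reals all_analysis.
From mathcomp Require Import measurable_realfun.
Import Order.TTheory GRing.Theory Num.Theory.
Import numFieldNormedType.Exports.

Set Implicit Arguments.
Unset Strict Implicit.
Unset Printing Implicit Defensive.

Local Open Scope classical_set_scope.
Local Open Scope ring_scope.

Section risk.
Context d (T : measurableType d) (R : realType).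

(* The value lies in ]-oo, +oo] whenever mu is a probability: lne +oo = +oo. *)
Definition entropic_risk (alpha : R) (mu : {measure set T -> \bar R})
    (X : T -> R) : \bar R :=
  ((alpha^-1)%:E * lne (\int[mu]_x (expR (alpha * X x))%:E))%E.

(* Uniform weights on the first N points of the sequence x. *)
Definition empirical (x : nat -> T) (N : nat) : {measure set T -> \bar R} :=
  mscale (N%:R^-1)%:nng (msum (fun i => \d_(x i)) N).

Definition mean (mu : {measure set T -> \bar R}) (X : T -> R) : R :=
  (\int[mu]_x X x)%R.

Definition stddev (mu : {measure set T -> \bar R}) (X : T -> R) : R :=
  Num.sqrt (\int[mu]_x (X x - mean mu X) ^+ 2)%R.

(* Medians need not be unique, hence a relation. *)
Definition is_median (P : probability T R) (Y : T -> \bar R) (m : \bar R) :=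
  ((2^-1)%:E <= P [set t | Y t <= m])%E /\
  ((2^-1)%:E <= P [set t | m <= Y t])%E.

Definition lighter_than_gaussian (P : probability T R) (X : T -> R) :=
  exists q G C : R, [/\ 2 < q, 0 < G, 0 < C &
    forall a : R, 0 <= a ->
      (P [set t | (a <= `|X t|)%R] <= (G * expR (- (C * a `^ q)))%:E)%E].

Definition mutually_independent d' (T' : measurableType d')
    (P : probability T R) (X : nat -> T -> T') :=
  forall (J : {fset nat}) (B : nat -> set T'), (forall i, measurable (B i)) ->
    P (\bigcap_(i in [set` J]) X i @^-1` B i) =
    (\prod_(i <- J) P (X i @^-1` B i))%E.

Definition same_law d1 (T1 : measurableType d1) (P : probability T R)
    (X : T -> R) (Q : probability T1 R) (Y : T1 -> R) :=
  forall B : set R, measurable B -> P (X @^-1` B) = Q (Y @^-1` B).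

End risk.
Arguments empirical {d T R} x N.

Section iid_law.
Context d (T : measurableType d) (R : realType).

Definition tcons n (p : T * n.-tuple T) : n.+1.-tuple T :=
  [the n.+1.-tuple T of p.1 :: p.2].

Lemma measurable_tcons n : measurable_fun setT (@tcons n).
Proof. exact: measurable_cons measurable_fst measurable_snd. Qed.

HB.instance Definition _ n :=
  isMeasurableFun.Build _ _ _ _ (@tcons n) (@measurable_tcons n).

(* The law of n i.i.d. draws from Q, i.e. the n-fold product of Q. *)
Fixpoint iid_law (Q : probability T R) (n : nat) : probability (n.-tuple T) R :=
  match n with
  | 0 => \d_([tuple] : 0.-tuple T)
  | m.+1 => distribution (Q \x iid_law Q m)%E (@tcons m)
  end.

Lemma iid_law_box (Q : probability T R) n (B : 'I_n -> set T) :
  (forall i, measurable (B i)) ->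
  iid_law Q n [set x | forall i, B i (tnth x i)] = (\prod_(i < n) Q (B i))%E.
Proof.
elim: n B => [|n IH] B mB.
  by rewrite big_ord0 /= diracE mem_set//= => -[].
rewrite big_ord_recl -IH; last by move=> i; exact: mB.
rewrite /= /distribution /pushforward.
rewrite -product_measure1E; last 2 first.
- exact: mB.
- rewrite (_ : [set x | _] = \bigcap_(i in [set: 'I_n])
     ((fun x : n.-tuple T => tnth x i) @^-1` B (lift ord0 i))).
    apply: fin_bigcap_measurable => // i _.
    by rewrite -[X in measurable X]setTI; exact: measurable_tnth.
  by apply/seteqP; split => [x h i _|x h i]; [exact: h|exact: h].
congr (_ _); apply/seteqP; split => [[a x]/= h|[a x]/= [ha hx] i].
  split; first exact: (h ord0).
  by move=> i; have := h (lift ord0 i); rewrite tnthS.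
by case: (unliftP ord0 i) => [j ->|->]; [rewrite tnthS; exact: hx|].
Qed.

End iid_law.

(* A decision problem together with its infinite i.i.d. data sequence; the
   N-th data set consists of its first N terms. The random vector eta is the
   identity on R^dim_eta, under its law. *)
Record loss_model (R : realType) := LossModel {
  dim_z : nat;
  decisions : set 'rV[R]_dim_z;
  dim_eta : nat;
  law : probability (dim_eta.-tuple R) R;
  loss : 'rV[R]_dim_z -> dim_eta.-tuple R -> R;
  measurable_loss : forall z, decisions z -> measurable_fun setT (loss z);
  disp : measure_display;
  Omega : measurableType disp;
  Pr : probability Omega R;
  sample : nat -> Omega -> dim_eta.-tuple R;
  measurable_sample : forall i, measurable_fun setT (sample i);
  sample_law : forall i B, measurable B -> Pr (sample i @^-1` B) = law B;
  sample_independent : mutually_independent Pr sample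
}.
Arguments Pr {R} M : rename.
Arguments law {R} M : rename.
Arguments sample {R} M i w : rename.
Arguments loss {R} M z e : rename.

Section model.
Context (R : realType) (M : loss_model R).

Definition location_scale d (T : measurableType d) (P : probability T R)
    (xi : T -> R) :=
  exists A : set (R * R), [/\
    forall ms, A ms -> 0 <= ms.2,
    forall z, decisions z -> exists2 ms, A ms &
      same_law (law M) (loss M z) P (fun t => ms.1 + ms.2 * xi t) &
    forall ms, A ms -> exists2 z, decisions z &
      same_law (law M) (loss M z) P (fun t => ms.1 + ms.2 * xi t)].

Variable z : 'rV[R]_(dim_z M).

Definition sigma : R := Num.sqrt (fine 'V_(law M)[loss M z]).

Definition scenarios N (w : Omega M) : N.-tuple R :=
  [tuple loss M z (sample M i w) | i < N].

Definition Phat N (w : Omega M) : {measure set (dim_eta M).-tuple R -> \bar R} :=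
  empirical (fun i => sample M i w) N.

Definition muhat N w : R := mean (Phat N w) (loss M z).

Definition sigmahat N w : R := stddev (Phat N w) (loss M z).

Definition sigmahat_gt0 :=
  forall N, (1 < N)%N -> {ae Pr M, forall w, 0 < sigmahat N w}.

(* fit N x is the law fitted on the data set x of size N. Sizes N <= 1 are
   excluded below: sigmahat vanishes for N = 1. *)
Variable fit : forall N, N.-tuple R -> probability R R.

Definition affine_equivariance :=
  forall N w (a b : R), (1 < N)%N -> 0 <= b ->
  forall B : set R, measurable B ->
    fit (scenarios N w) ((fun y => a + b * y) @^-1` B) =
    fit (map_tuple (fun y => a + b * y) (scenarios N w)) B.

Definition mean_matching :=
  forall N, (1 < N)%N -> {ae Pr M, forall w,
    (\int[fit (scenarios N w)]_y y%:E = (muhat N w)%:E)%E}.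

Definition heavy_gaussian_right_tails :=
  exists c1 c2 abar : R, [/\ 0 < c1, 0 < c2, 0 < abar &
    forall N, (1 < N)%N -> {ae Pr M, forall w, forall a : R, abar <= a ->
      ((c1 * expR (- (a ^+ 2 / c2 ^+ 2)))%:E <=
       fit (scenarios N w)
         [set y | (a <= (y - muhat N w) / sigmahat N w)%R])%E}].

Definition subgaussian_tails :=
  exists2 c3 : R, 0 < c3 &
    forall N, (1 < N)%N -> {ae Pr M, forall w, forall a : R, 0 <= a ->
      (fit (scenarios N w)
         [set y | (a <= `|y - muhat N w| / sigmahat N w)%R] <=
       (2 * expR (- (a ^+ 2 / c3 ^+ 2)))%:E)%E}.

Variables (alpha : R) (delta : forall N, N.-tuple R -> \bar R).

Definition true_risk : \bar R := entropic_risk alpha (law M) (loss M z).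

Definition corrected_risk N w : \bar R :=
  (entropic_risk alpha (Phat N w) (loss M z) + delta (scenarios N w))%E.

Definition expected_corrected_risk N : \bar R :=
  (\int[Pr M]_w corrected_risk N w)%E.

End model.

(* rho_Q(zeta) - rho_Qhat(zeta), where Qhat is the empirical distribution of
   the draws y. *)
Definition risk_gap (R : realType) (alpha : R) (Q : probability R R) N
    (y : N.-tuple R) : \bar R :=
  (entropic_risk alpha Q idfun -
   entropic_risk alpha (empirical (nth 0%R y) N) idfun)%E.

(* delta N x is a median of the risk gap of fit x, over N i.i.d. draws from
   fit x. Where medians are not unique, any measurable choice is allowed. *)
Definition median_bias (R : realType) (alpha : R)
    (fit : forall N, N.-tuple R -> probability R R)
    (delta : forall N, N.-tuple R -> \bar R) :=
  forall N, (1 < N)%N -> measurable_fun setT (fun x : N.-tuple R => delta N x) /\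
    forall x : N.-tuple R,
      is_median (iid_law (fit N x) N) (@risk_gap R alpha (fit N x) N)
        (delta N x).

(* Main.v *)
Require Import Defs.
From HB Require Import structures.
From mathcomp Require Import all_boot all_order all_algebra.
From mathcomp Require Import all_classical all_reals all_analysis.
From mathcomp Require Import measurable_realfun.
From mathcomp Require Import finmap ring lra.
Import Order.TTheory GRing.Theory Num.Theory.
Import numFieldNormedType.Exports.

(** Let [mu] and [s] be the mean and the standard deviation of the loss, so that
    it has the law of [mu + s xi].

    The risk of a sample is at least its mean and at most its maximum, and the
    true risk is at least [mu] by Jensen's inequality. As the tails of [xi] are
    lighter than Gaussian, [exp (k xi^2)] is integrable for every [k], and
    [alpha s xi <= (alpha s)^2 / l + l xi^2 / 4] shows that the true risk is at
    most [mu + e s^2] plus a constant, for [e] as small as we please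
    ([true_risk_le]). Up to a constant and a small multiple of [s^2], the
    estimator without its correction [delta] is therefore not below the true
    risk on average, and everything depends on [delta].

    The correction is a median, so bounding it means finding an event of
    probability more than one half for the draws from the fitted law. Markov's
    inequality bounds [delta] below by the constant [- ln 3 / alpha]
    ([risk_gap_median_ge]). If the sample has mean [m] and spread [t / alpha] and
    the fitted law a heavy Gaussian right tail on that scale, its risk exceeds
    [m] by a multiple of [t^2], while the maximum of the draws typically exceeds
    [m] by a multiple of [t] only ([heavy_tail_median_ge]); with subgaussian tails the risk exceeds [m] by at
    most a multiple of [t^2] ([subgaussian_median_le]). The spread of the sample
    is [s] times the spread of the standardized sample, so the expectation of
    [delta] is bounded below by a multiple of [s^2], through samples of positive
    probability whose standardized spread is not small
    ([expected_overestimation]), and above by a multiple of [s^2]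
    ([expected_upper_bound]).

    The constants in these bounds must not depend on the decision problem.
    Affine equivariance makes the standardized fitted law a function of the
    standardized sample, and all decision problems share the law of the sample
    standardized by [mu] and [s]. A tail bound that holds almost surely in one
    problem of positive variance thus holds, with the same constants, in all of
    them ([ae_standardized_tuple]). For this the tail conditions must define
    measurable sets of samples; they are used at integer thresholds only.

    For consistency, the strong law of large numbers holds for the exponentials
    and the squares of the losses. It is proved with fourth moments, computed
    along the recursive product that defines the law of a sample
    ([iid_law_fourth_moment]). The squares keep the spread of the sample bounded
    along almost every path. The fourth moments of the exponential of the draws,
    relative to its expectation, are then bounded as well: here mean matching
    keeps that expectation away from zero. The same fourth-moment estimate shows
    that the correction tends to zero ([ae_delta_cvg0]). *)

Local Open Scope classical_set_scope.
Local Open Scope ring_scope.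

Set Implicit Arguments.
Unset Strict Implicit.
Unset Printing Implicit Defensive.

(** * Integrals *)

Section integrals.
Context {d} {T : measurableType d} {R : realType}.
Implicit Types mu : {measure set T -> \bar R}.

(** The positive and the negative parts are compared separately, subtraction on
    the extended reals being monotone even where it takes its conventional
    value on two infinities. *)
Lemma ae_le_integral_measurable mu (f g : T -> \bar R) :
  measurable_fun setT f -> measurable_fun setT g ->
  {ae mu, forall x, (f x <= g x)%E} ->
  (\int[mu]_x f x <= \int[mu]_x g x)%E.
Proof.
move=> mf mg fg; rewrite integralE [leRHS]integralE; apply: leeB.
  apply: ae_ge0_le_integral => //; [exact: measurable_funepos..|].
  apply: filterS fg => x fgx _.
  by rewrite !funeposE ge_max !le_max lexx orbT fgx.
apply: ae_ge0_le_integral => //; [exact: measurable_funeneg..|].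
apply: filterS fg => x fgx _.
by rewrite !funenegE ge_max !le_max lexx orbT leeN2 fgx.
Qed.

Lemma integral_empirical (f : T -> R) (x : nat -> T) N :
  measurable_fun setT f ->
  (\int[empirical x N]_y (f y)%:E = (N%:R^-1 * \sum_(i < N) f (x i))%:E)%E.
Proof.
have ge0 (g : T -> R) : (forall y, 0 <= g y) -> measurable_fun setT g ->
    (\int[empirical x N]_y (g y)%:E = (N%:R^-1 * \sum_(i < N) g (x i))%:E)%E.
  move=> g0 /measurable_EFinP mg.
  rewrite /empirical ge0_integral_mscale//; last by move=> y _; rewrite lee_fin.
  rewrite ge0_integral_measure_sum//; last by move=> y _; rewrite lee_fin.
  rewrite EFinM -sumEFin /=; congr (_ * _)%E; apply: eq_bigr => i _.
  by rewrite integral_dirac//= diracT mul1e.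
move=> mf; rewrite integralE.
rewrite (_ : (_ \o f)^\+%E = EFin \o (fun y => Num.max (f y) 0)); last first.
  by apply/funext => y; rewrite funeposE /= EFin_max.
rewrite (_ : (_ \o f)^\-%E = EFin \o (fun y => Num.max (- f y) 0)); last first.
  by apply/funext => y; rewrite funenegE /= EFin_max.
have m0 : measurable_fun setT (cst 0 : T -> R) by exact: measurable_cst.
rewrite (ge0 (fun y => Num.max (f y) 0)); last 2 first.
- by move=> y; rewrite le_max lexx orbT.
- exact: measurable_maxr.
rewrite (ge0 (fun y => Num.max (- f y) 0)); last 2 first.
- by move=> y; rewrite le_max lexx orbT.
- by apply: measurable_maxr => //; exact: measurable_funN.
rewrite -EFinB -mulrBr -sumrB; congr (_ * _)%:E; apply: eq_bigr => i _.
rewrite /Num.max oppr_lt0; case: ltgtP => //; lra.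
Qed.

End integrals.

Lemma same_law_integral {d1 d2} {T1 : measurableType d1}
    {T2 : measurableType d2} {R : realType} (P : probability T1 R)
    (Q : probability T2 R) (X : T1 -> R) (Y : T2 -> R) (f : R -> \bar R) :
  measurable_fun setT X -> measurable_fun setT Y -> same_law P X Q Y ->
  measurable_fun setT f -> (\int[P]_x f (X x) = \int[Q]_y f (Y y))%E.
Proof.
move=> mX mY XY mf.
have ge0 (g : R -> \bar R) : (forall y, 0 <= g y)%E -> measurable_fun setT g ->
    (\int[P]_x g (X x) = \int[Q]_y g (Y y))%E.
  move=> g0 mg.
  transitivity (\int[pushforward P X]_y g y)%E.
    by rewrite ge0_integral_pushforward.
  transitivity (\int[pushforward Q Y]_y g y)%E; last first.
    by rewrite ge0_integral_pushforward.
  apply: eq_measure_integral => A mA _; exact: XY.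
rewrite integralE [RHS]integralE; congr (_ - _)%E.
  rewrite (funepos_comp f X) (funepos_comp f Y).
  exact: (ge0 f^\+%E (funepos_ge0 f) (measurable_funepos mf)).
rewrite (funeneg_comp f X) (funeneg_comp f Y).
exact: (ge0 f^\-%E (funeneg_ge0 f) (measurable_funeneg mf)).
Qed.

(** * Laws of finite samples *)

Section tuples.
Context {d} {T : measurableType d} {R : realType}.

(** Boxes are stable under intersection and generate the product
    sigma-algebra. *)
Lemma tuple_measure_unique n (P Q : probability (n.-tuple T) R) :
  (forall B : 'I_n -> set T, (forall i, measurable (B i)) ->
    P [set x | forall i, B i (tnth x i)] =
    Q [set x | forall i, B i (tnth x i)]) ->
  forall S, measurable S -> P S = Q S.
Proof.
move=> PQ S mS.
pose G := [set S : set (n.-tuple T) | exists B : 'I_n -> set T,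
  (forall i, measurable (B i)) /\ S = [set x | forall i, B i (tnth x i)]].
apply: (measure_unique G (fun=> setT)) => //.
- apply/seteqP; split.
    apply: smallest_sub; first exact: smallest_sigma_algebra.
    rewrite -bigcup_seq; apply: bigcup_sub => i _ A [B mB <-].
    apply: sub_sigma_algebra.
    exists (fun j => if j == i then B else setT); split=> [j|].
      by case: ifP.
    apply/seteqP; split=> x /=; first by move=> [_ Bx] j; case: eqP => // ->.
    by move=> /(_ i); rewrite eqxx; split.
  apply: smallest_sub; first exact: sigma_algebra_measurable.
  move=> _ [B [mB ->]].
  rewrite (_ : [set x | _] = \bigcap_(i in [set: 'I_n])
     ((fun x : n.-tuple T => tnth x i) @^-1` B i)).
    apply: fin_bigcap_measurable => // i _.
    by rewrite -[X in measurable X]setTI; exact: measurable_tnth.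
  by apply/seteqP; split=> [x h i _|x h i]; [exact: h|exact: h].
- move=> _ _ [B [mB ->]] [C [mC ->]]; exists (fun i => B i `&` C i).
  split=> [i|]; first exact: measurableI.
  apply/seteqP; split=> x /=; first by move=> [Bx Cx] i; split.
  by move=> BCx; split=> i; case: (BCx i).
- by move=> _; exists (fun=> setT); split=> //; apply/seteqP; split.
- by rewrite bigcup_const.
- by move=> _ [B [mB ->]]; exact: PQ.
- by move=> k; apply: le_lt_trans (ltry 1); exact: (probability_le1 P measurableT).
Qed.

End tuples.

Section iid_tuple.
Context {d} {Omega : measurableType d} {d'} {T : measurableType d'}
  {R : realType} (P : probability Omega R) (X : nat -> Omega -> T).
Hypotheses (mX : forall i, measurable_fun setT (X i))
  (indX : mutually_independent P X).

Definition sample_tuple N (w : Omega) : N.-tuple T := [tuple X i w | i < N].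

Lemma measurable_sample_tuple N : measurable_fun setT (sample_tuple N).
Proof.
apply/measurable_fun_tnthP => i; rewrite (_ : _ \o _ = X i)//.
by apply/funext => w; rewrite /= tnth_mktuple.
Qed.

Lemma sample_tuple_law (Q : probability T R) N S :
  (forall i B, measurable B -> P (X i @^-1` B) = Q B) ->
  measurable S -> P (sample_tuple N @^-1` S) = iid_law Q N S.
Proof.
move=> XQ mS.
pose F : {mfun Omega >-> N.-tuple T} :=
  HB.pack (sample_tuple N)
    (isMeasurableFun.Build _ _ _ _ (sample_tuple N) (@measurable_sample_tuple N)).
apply: (@tuple_measure_unique _ _ _ _ (distribution P F)) => // B mB.
rewrite iid_law_box//.
pose C i := if insub i is Some j then B j else setT.
have mC i : measurable (C i) by rewrite /C; case: insub.
have CE (i : 'I_N) : C i = B i by rewrite /C valK.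
pose J : {fset nat} := [fset i in iota 0 N]%fset.
have := indX J mC.
rewrite (_ : \bigcap_(i in _) _ = sample_tuple N @^-1`
    [set x | forall i, B i (tnth x i)]).
  move=> H; etransitivity; first exact: H.
  rewrite (eq_bigr (fun i => Q (C i))); last by move=> i _; exact: XQ.
  transitivity (\prod_(i <- iota 0 N) Q (C i))%E.
    apply: perm_big; apply: uniq_perm => [||i]; rewrite ?fset_uniq ?iota_uniq//.
    by rewrite /J in_fset.
  rewrite -[X in iota 0 X]subn0 -/(index_iota 0 N) big_mkord.
  by apply: eq_bigr => i _; rewrite CE.
apply/seteqP; split => w /= h i.
  rewrite tnth_mktuple -CE; apply: h.
  by rewrite /J /= in_fset mem_iota /= add0n.
rewrite /J /= in_fset mem_iota /= add0n => iN.
by have := h (Ordinal iN); rewrite tnth_mktuple -CE.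
Qed.

End iid_tuple.

Lemma integral_lincomb {d} {T : measurableType d} {R : realType}
    (mu : {measure set T -> \bar R}) (I : finType) (c : I -> R)
    (f : I -> T -> R) :
  (forall i, mu.-integrable setT (EFin \o f i)) ->
  (\int[mu]_x (\sum_i c i * f i x)%:E =
   (\sum_i c i * fine (\int[mu]_x (f i x)%:E))%:E)%E.
Proof.
move=> intf.
under eq_integral do rewrite -sumEFin.
rewrite integral_sum//; last first.
  by move=> i; apply: (integrableZl measurableT) (intf i).
rewrite -sumEFin; apply: eq_bigr => i _.
under eq_integral do rewrite EFinM.
rewrite integralZl//; last exact: intf.
by rewrite EFinM fineK//; exact: integrable_fin_num (intf i).
Qed.

Lemma integrable_powers {d} {T : measurableType d} {R : realType}
    (P : probability T R) (h : T -> R) n k : (k <= n.*2)%N ->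
  measurable_fun setT h -> (\int[P]_x (h x ^+ n.*2)%:E < +oo)%E ->
  P.-integrable setT (EFin \o (fun x => h x ^+ k)).
Proof.
move=> kn mh hn.
have i1 : P.-integrable setT (EFin \o (fun x => 1 + h x ^+ n.*2)).
  rewrite (_ : _ \o _ = cst 1%E \+ (EFin \o (fun x => h x ^+ n.*2)))//.
  apply: integrableD => //; first exact: finite_measure_integrable_cst.
  apply/integrableP; split.
    by apply/measurable_EFinP; exact: measurable_funX.
  under eq_integral do rewrite /= ger0_norm ?exprn_even_ge0 ?odd_double//.
  by [].
apply: le_integrable i1 => //.
  by apply/measurable_EFinP; exact: measurable_funX.
move=> x _ /=; rewrite lee_fin [leRHS]ger0_norm; last first.
  by rewrite addr_ge0// exprn_even_ge0// odd_double.
rewrite -(@ger0_norm _ (h x ^+ n.*2)) ?exprn_even_ge0 ?odd_double//.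
rewrite !normrX; have [h1|h1] := leP `|h x| 1.
  by apply: (@le_trans _ _ 1); [exact: exprn_ile1|rewrite lerDl exprn_ge0].
by rewrite (le_trans (ler_weXn2l (ltW h1) kn))// lerDr.
Qed.

Section iid_moments.
Context {R : realType} (Q : probability R R).

Lemma iid_law_marginal n (i : 'I_n) (B : set R) : measurable B ->
  iid_law Q n ((fun x => tnth x i) @^-1` B) = Q B.
Proof.
move=> mB; pose C j := if j == i then B else setT.
have mC j : measurable (C j) by rewrite /C; case: ifP.
transitivity (iid_law Q n [set x | forall j, C j (tnth x j)]).
  congr (iid_law Q n _); apply/seteqP; split=> x /=.
    by move=> Bx j; rewrite /C; case: eqP => // ->.
  by move=> /(_ i); rewrite /C eqxx.
rewrite iid_law_box// (bigD1 i)//= {1}/C eqxx big1 ?mule1// => j ji.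
by rewrite /C (negbTE ji) probability_setT.
Qed.

Lemma iid_law_integral_sum n (f : R -> R) :
  (forall y, 0 <= f y) -> measurable_fun setT f ->
  (\int[iid_law Q n]_x (\sum_(i < n) f (tnth x i))%:E =
   n%:R%:E * \int[Q]_y (f y)%:E)%E.
Proof.
move=> f0 mf; have mfE : measurable_fun setT (EFin \o f) by exact/measurable_EFinP.
under eq_integral do rewrite -sumEFin.
rewrite ge0_integral_sum//; last 2 first.
- move=> i; apply: (measurableT_comp mfE); exact: measurable_tnth.
- by move=> i x _; rewrite lee_fin.
rewrite (eq_bigr (fun=> \int[Q]_y (f y)%:E)%E).
  rewrite big_const_ord mule_natl.
  by elim: n => [|n IH] //; rewrite iterS IH muleS.
move=> i _.
apply: (@same_law_integral _ _ _ _ _ (iid_law Q n) Q (fun x => tnth x i) idfun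
  (EFin \o f)) => //.
- exact: measurable_tnth.
- exact: measurable_id.
- by move=> B mB; exact: iid_law_marginal.
Qed.

(** Bernoulli's inequality bounds the product of the probabilities. *)
Lemma iid_law_forall_ge n (B : set R) (e : R) : 0 <= e -> measurable B ->
  ((1 - e)%:E <= Q B)%E ->
  ((1 - n%:R * e)%:E <= iid_law Q n [set x | forall i, B (tnth x i)])%E.
Proof.
move=> e0 mB eB; rewrite (iid_law_box Q (fun=> mB)).
have qf : Q B \is a fin_num by exact: fin_num_measure.
rewrite big_const_ord -(fineK qf).
have -> : iter n (mule (fine (Q B))%:E) 1%E = (fine (Q B) ^+ n)%:E.
  by elim: n => [|n IH] //=; rewrite IH -EFinM exprS.
move: eB; rewrite -{1}(fineK qf) !lee_fin => eB.
have q0 : 0 <= fine (Q B) by exact: fine_ge0.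
have q1 : fine (Q B) <= 1 by rewrite -lee_fin fineK//; exact: probability_le1.
elim: n => [|n IH]; first by rewrite mul0r subr0 expr0.
rewrite exprSr.
have : fine (Q B) ^+ n <= 1 by exact: exprn_ile1.
have : 0 <= fine (Q B) ^+ n by exact: exprn_ge0.
move: (fine (Q B) ^+ n) (fine (Q B)) eB q0 q1 IH => p q.
rewrite -natr1 => *; nra.
Qed.

Lemma iid_law_integral_recl n (f : n.+1.-tuple R -> \bar R) :
  measurable_fun setT f -> (forall x, 0 <= f x)%E ->
  (\int[iid_law Q n.+1]_x f x =
   \int[Q]_a \int[iid_law Q n]_t f [tuple of a :: t])%E.
Proof.
move=> mf f0 /=; rewrite ge0_integral_distribution//.
apply: fubini_tonelli1 => [|x]; last exact: f0.
exact: (measurableT_comp mf (measurable_tcons (n:=n))).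
Qed.

(** Translating the sum by an arbitrary [c] makes the claim inductive: the
    recursion on the sample size integrates one coordinate at a time, and the
    coordinate that remains plays the role of a translation. *)
Lemma iid_law_fourth_moment (h : R -> R) (m : R) n :
  measurable_fun setT h -> (\int[Q]_y (h y)%:E = 0)%E ->
  (\int[Q]_y (h y ^+ 4)%:E <= m%:E)%E ->
  (\int[iid_law Q n]_x ((\sum_(i < n) h (tnth x i)) ^+ 4)%:E <=
   (3 * n%:R ^+ 2 * m)%:E)%E.
Proof.
move=> mh h1 h4.
have inth k : (k <= 4)%N -> Q.-integrable setT (EFin \o (fun y => h y ^+ k)).
  by move=> k4; apply: (@integrable_powers _ _ _ _ _ 2) => //; exact: le_lt_trans (ltry m).
pose mo k := fine (\int[Q]_y (h y ^+ k)%:E)%E.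
have mo0 : mo 0 = 1.
  rewrite /mo; under eq_integral do rewrite expr0.
  by rewrite integral_cst//= mul1e probability_setT.
have mo1 : mo 1 = 0.
  by rewrite /mo; under eq_integral do rewrite expr1; rewrite h1.
have mo4 : mo 4 <= m.
  by rewrite -lee_fin fineK//; exact: (integrable_fin_num _ (inth 4 _)).
have polE (c : nat -> R) : (\int[Q]_y (c 0 + c 1 * h y + c 2 * h y ^+ 2
    + c 3 * h y ^+ 3 + c 4 * h y ^+ 4)%:E =
    (c 0 + c 2 * mo 2 + c 3 * mo 3 + c 4 * mo 4)%:E)%E.
  transitivity (\int[Q]_y (\sum_(k < 5) c k * h y ^+ k)%:E)%E.
    apply: eq_integral => y _; congr EFin.
    by rewrite !big_ord_recr big_ord0 /= expr0 expr1 mulr1 add0r.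
  rewrite (@integral_lincomb _ _ _ Q _ (fun k : 'I_5 => c k)
    (fun k y => h y ^+ k)); last by move=> k; apply: inth; rewrite -ltnS.
  rewrite !big_ord_recr big_ord0 /=.
  by rewrite -!/(mo _) mo0 mo1 mulr1 mulr0 add0r addr0.
have mo24 : mo 2 ^+ 2 <= mo 4.
  have := polE (fun k => nth 0 [:: mo 2 ^+ 2; 0; - (mo 2 *+ 2); 0; 1] k).
  rewrite /= => E.
  have : (0 <= \int[Q]_y (mo 2 ^+ 2 + 0 * h y + - (mo 2 *+ 2) * h y ^+ 2 +
      0 * h y ^+ 3 + 1 * h y ^+ 4)%:E)%E.
    apply: integral_ge0 => y _; rewrite lee_fin.
    have -> : mo 2 ^+ 2 + 0 * h y + - (mo 2 *+ 2) * h y ^+ 2 + 0 * h y ^+ 3 +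
      1 * h y ^+ 4 = (mo 2 - h y ^+ 2) ^+ 2 by ring.
    exact: sqr_ge0.
  rewrite E lee_fin; nra.
pose K n : R := n%:R * mo 4 + 3 * n%:R * (n%:R - 1) * mo 2 ^+ 2.
have mS k : measurable_fun setT (fun x : k.-tuple R => \sum_(i < k) h (tnth x i)).
  apply: measurable_sum => i; apply: measurableT_comp => //.
  exact: measurable_tnth.
have main c : (\int[iid_law Q n]_x ((c + \sum_(i < n) h (tnth x i)) ^+ 4)%:E =
    (c ^+ 4 + 6 * c ^+ 2 * n%:R * mo 2 + 4 * c * n%:R * mo 3 + K n)%:E)%E.
  elim: n c => [|k IH] c.
    under eq_integral do rewrite big_ord0 addr0.
    by rewrite integral_cst//= probability_setT mule1; congr EFin; rewrite /K; ring.
  rewrite iid_law_integral_recl; last 2 first.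
  - apply/measurable_EFinP; apply: measurable_funX.
    by apply: measurable_funD; [exact: measurable_cst|exact: mS].
  - by move=> x; rewrite lee_fin exprn_even_ge0.
  transitivity (\int[Q]_a (((c + h a) ^+ 4 + 6 * (c + h a) ^+ 2 * k%:R * mo 2
      + 4 * (c + h a) * k%:R * mo 3 + K k))%:E)%E.
    apply: eq_integral => a _; rewrite -IH; apply: eq_integral => x _.
    rewrite big_ord_recl (tnth_nth 0) /= addrA; congr ((_ + _) ^+ 4)%:E.
    by apply: eq_bigr => i _; rewrite tnthS.
  have := polE (fun j => nth 0 [::
    c ^+ 4 + 6 * c ^+ 2 * k%:R * mo 2 + 4 * c * k%:R * mo 3 + K k;
    4 * c ^+ 3 + 12 * c * k%:R * mo 2 + 4 * k%:R * mo 3;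
    6 * c ^+ 2 + 6 * k%:R * mo 2; 4 * c; 1] j).
  rewrite /= => E; transitivity ((c ^+ 4 + 6 * c ^+ 2 * k%:R * mo 2 +
    4 * c * k%:R * mo 3 + K k + (6 * c ^+ 2 + 6 * k%:R * mo 2) * mo 2 +
    4 * c * mo 3 + 1 * mo 4)%:E).
    by rewrite -E; apply: eq_integral => y _; congr EFin; ring.
  by congr EFin; rewrite /K -natr1; ring.
under eq_integral do rewrite -[X in X ^+ 4]add0r.
rewrite main lee_fin /K.
have n0 : 0 <= n%:R :> R by [].
have mo40 : 0 <= mo 4 by apply: le_trans mo24; exact: sqr_ge0.
have : (n = 0)%N \/ 1 <= n%:R :> R by case: (n) => [|k]; [left|right; rewrite ler1n].
case=> [->|n1]; first by rewrite !mul0r expr0n /=; lra.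
have n1' : 0 <= n%:R - 1 :> R by rewrite subr_ge0.
have a1 : 0 <= n%:R * (n%:R - 1) * (mo 4 - mo 2 ^+ 2).
  by rewrite !mulr_ge0// subr_ge0.
have a2 : 0 <= n%:R ^+ 2 * (m - mo 4) by rewrite mulr_ge0// subr_ge0.
have a3 : 0 <= n%:R * mo 4 by rewrite mulr_ge0.
lra.
Qed.

End iid_moments.

(** * Medians of the risk gap *)

Section median.
Context {d} {T : measurableType d} {R : realType} (P : probability T R).

Lemma measurable_lee_set (f g : T -> \bar R) :
  measurable_fun setT f -> measurable_fun setT g ->
  measurable [set t | f t <= g t]%E.
Proof.
move=> mf mg; rewrite -[[set t | _]]setTI.
exact: measurable_lee.
Qed.

Lemma measurable_ler_set (f g : T -> R) :
  measurable_fun setT f -> measurable_fun setT g ->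
  measurable [set t | f t <= g t].
Proof.
move=> /measurable_EFinP mf /measurable_EFinP mg.
exact: (measurable_lee_set mf mg).
Qed.

Lemma measurable_ltr_set (f g : T -> R) :
  measurable_fun setT f -> measurable_fun setT g ->
  measurable [set t | f t < g t].
Proof.
move=> mf mg; rewrite (_ : [set t | _] = ~` [set t | g t <= f t]).
  exact/measurableC/measurable_ler_set.
by apply/seteqP; split=> t /=; [rewrite ltNge => /negP|move/negP; rewrite -ltNge].
Qed.

Lemma probability_integral_gt0 (f : T -> R) :
  measurable_fun setT f -> (forall t, 0 < f t) ->
  (0 < \int[P]_t (f t)%:E)%E.
Proof.
move=> mf f0; have /measurable_EFinP mfE := mf.
rewrite lt_neqAle integral_ge0 ?andbT; last by move=> t _; rewrite lee_fin ltW.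
apply/eqP => /esym I0.
have [+ _] := ae_eq_integral_abs P measurableT mfE.
under eq_integral do rewrite /= gtr0_norm//.
move=> /(_ I0) aef.
have : P.-negligible setT.
  by apply: negligibleS aef => t _ /= /(_ I)/eqP; rewrite eqe gt_eqF.
move=> /(negligibleP _ measurableT) P0.
by have := probability_setT P; rewrite [LHS]P0 => /eqP; rewrite eqe eq_sym oner_eq0.
Qed.

(** An event of probability more than one half meets both half-lines that a
    median cuts out. *)
Lemma median_ge (Y : T -> \bar R) (m L : \bar R) (A : set T) :
  measurable_fun setT Y -> is_median P Y m -> measurable A ->
  ((2^-1)%:E < P A)%E -> (forall t, A t -> (L <= Y t)%E) -> (L <= m)%E.
Proof.
move=> mY [m1 _] mA PA AL; rewrite leNgt; apply/negP => mL.
have : (P [set t | Y t <= m] <= P (~` A))%E.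
  apply: le_measure.
  - by apply/mem_set; exact: (measurable_lee_set mY (measurable_cst m)).
  - by apply/mem_set; exact: measurableC.
  - by move=> t /= Ytm At; have := lt_le_trans mL (AL t At); rewrite ltNge Ytm.
rewrite probability_setC// => /(le_trans m1).
have : P A \is a fin_num by exact: fin_num_measure.
case: (P A) PA => [p| |]// + _; rewrite lte_fin -EFinB lee_fin => h1 h2.
clear -h1 h2; lra.
Qed.

Lemma median_le (Y : T -> \bar R) (m U : \bar R) (A : set T) :
  measurable_fun setT Y -> is_median P Y m -> measurable A ->
  ((2^-1)%:E < P A)%E -> (forall t, A t -> (Y t <= U)%E) -> (m <= U)%E.
Proof.
move=> mY [_ m2] mA PA AU; rewrite leNgt; apply/negP => Um.
have : (P [set t | m <= Y t] <= P (~` A))%E.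
  apply: le_measure.
  - by apply/mem_set; exact: (measurable_lee_set (measurable_cst m) mY).
  - by apply/mem_set; exact: measurableC.
  - by move=> t /= Ytm At; have := le_lt_trans (AU t At) Um; rewrite ltNge Ytm.
rewrite probability_setC// => /(le_trans m2).
have : P A \is a fin_num by exact: fin_num_measure.
case: (P A) PA => [p| |]// + _; rewrite lte_fin -EFinB lee_fin => h1 h2.
clear -h1 h2; lra.
Qed.

(** Markov's inequality, for the complementary event. *)
Lemma probability_lt_ge (f : T -> R) (c e : R) : 0 < c ->
  measurable_fun setT f -> (forall t, 0 <= f t) ->
  (\int[P]_t (f t)%:E <= e%:E)%E ->
  ((1 - e / c)%:E <= P [set t | (f t < c)%R])%E.
Proof.
move=> c0 mf f0 fe.
have mA : measurable [set t | c <= f t].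
  exact: (measurable_ler_set (measurable_cst c) mf).
rewrite (_ : [set t | f t < c] = ~` [set t | c <= f t]); last first.
  by apply/seteqP; split=> t /=; [rewrite ltNge => /negP|move/negP; rewrite -ltNge].
rewrite probability_setC// EFinB leeB//.
rewrite -(@lee_pmul2l _ c%:E)// -EFinM mulrCA divff ?gt_eqF// mulr1.
apply: le_trans fe.
have /measurable_EFinP mfE := mf.
have := le_integral_abse P measurableT mfE c0; rewrite setTI /=.
under eq_set do rewrite ger0_norm// lee_fin.
by under eq_integral do rewrite /= ger0_norm//.
Qed.

End median.

Section entropic_risk.
Context {d} {T : measurableType d} {R : realType} (alpha : R).
Hypothesis alpha0 : 0 < alpha.
Implicit Types (mu : {measure set T -> \bar R}) (X : T -> R).

Lemma entropic_risk_EFin mu X (e : R) : 0 < e ->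
  (\int[mu]_x (expR (alpha * X x))%:E = e%:E)%E ->
  entropic_risk alpha mu X = (alpha^-1 * ln e)%:E.
Proof. by move=> e0 eE; rewrite /entropic_risk eE lne_EFin. Qed.

Lemma entropic_risk_ge mu X r :
  ((expR (alpha * r))%:E <= \int[mu]_x (expR (alpha * X x))%:E)%E ->
  (r%:E <= entropic_risk alpha mu X)%E.
Proof.
move=> rX; rewrite /entropic_risk.
have -> : r%:E = ((alpha^-1)%:E * lne (expR (alpha * r))%:E)%E.
  by rewrite lne_EFin ?expR_gt0// expRK -EFinM mulKf// gt_eqF.
rewrite lee_pmul2l ?lte_fin ?invr_gt0// lee_lne// in_itv/= leey andbT.
  by rewrite lee_fin expR_ge0.
by apply: le_trans rX; rewrite lee_fin expR_ge0.
Qed.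

Lemma entropic_risk_le mu X r :
  (\int[mu]_x (expR (alpha * X x))%:E <= (expR (alpha * r))%:E)%E ->
  (entropic_risk alpha mu X <= r%:E)%E.
Proof.
move=> rX; rewrite /entropic_risk.
have -> : r%:E = ((alpha^-1)%:E * lne (expR (alpha * r))%:E)%E.
  by rewrite lne_EFin ?expR_gt0// expRK -EFinM mulKf// gt_eqF.
rewrite lee_pmul2l ?lte_fin ?invr_gt0// lee_lne// in_itv/= leey andbT.
  by apply: integral_ge0 => x _; rewrite lee_fin expR_ge0.
by rewrite lee_fin expR_ge0.
Qed.

End entropic_risk.

Section tuple_statistics.
Context {R : realType}.
Implicit Types (N : nat) (alpha : R).

(** The mean, the standard deviation and the entropic risk of the uniform law on
    the entries of a sample, as functions of the sample. *)
Definition tmean N (x : N.-tuple R) := N%:R^-1 * \sum_(i < N) tnth x i.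

Definition tsdev N (x : N.-tuple R) :=
  Num.sqrt (N%:R^-1 * \sum_(i < N) (tnth x i - tmean x) ^+ 2).

Definition trisk alpha N (x : N.-tuple R) :=
  alpha^-1 * ln (N%:R^-1 * \sum_(i < N) expR (alpha * tnth x i)).

Lemma measurable_tuple_sum N (f : R -> R) : measurable_fun setT f ->
  measurable_fun setT (fun x : N.-tuple R => N%:R^-1 * \sum_(i < N) f (tnth x i)).
Proof.
move=> mf; apply: measurable_funM; first exact: measurable_cst.
by apply: measurable_sum => i; apply: measurableT_comp => //; exact: measurable_tnth.
Qed.

Lemma measurable_tmean N : measurable_fun setT (@tmean N).
Proof. exact: (@measurable_tuple_sum N idfun (@measurable_id _ _ setT)). Qed.

Lemma measurable_tsdev N : measurable_fun setT (@tsdev N).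
Proof.
have msq : measurable_fun setT (@Num.sqrt R).
  by apply: continuous_measurable_fun; exact: sqrt_continuous.
apply: (measurableT_comp msq (g := fun x : N.-tuple R =>
  N%:R^-1 * \sum_(i < N) (tnth x i - tmean x) ^+ 2)).
apply: measurable_funM; first exact: measurable_cst.
apply: measurable_sum => i; apply: measurable_funX.
by apply: measurable_funB; [exact: measurable_tnth|exact: measurable_tmean].
Qed.

Lemma measurable_expRM alpha : measurable_fun setT (fun y : R => expR (alpha * y)).
Proof.
apply: (measurableT_comp (@measurable_expR R) (g := fun y : R => alpha * y)).
by apply: measurable_funM; [exact: measurable_cst|exact: measurable_id].
Qed.

Lemma measurable_trisk alpha N : measurable_fun setT (@trisk alpha N).
Proof.
apply: measurable_funM; first exact: measurable_cst.
apply: (measurableT_comp (@measurable_ln R) (g := fun x : N.-tuple R =>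
  N%:R^-1 * \sum_(i < N) expR (alpha * tnth x i))).
exact: (@measurable_tuple_sum N (fun y => expR (alpha * y)) (measurable_expRM alpha)).
Qed.

Lemma entropic_risk_empirical {d} {T : measurableType d} alpha (x : nat -> T) N
    (X : T -> R) : (0 < N)%N -> measurable_fun setT X ->
  entropic_risk alpha (empirical x N) X =
  (trisk alpha [tuple X (x i) | i < N])%:E.
Proof.
move=> N0 mX; have NR : 0 < N%:R :> R by rewrite ltr0n.
rewrite /entropic_risk integral_empirical; last first.
  by apply: (measurableT_comp (measurable_expRM alpha)).
rewrite lne_EFin; last first.
  rewrite mulr_gt0 ?invr_gt0//; case: N N0 NR => // N _ _.
  by rewrite big_ord_recl ltr_pwDl ?expR_gt0// sumr_ge0// => i _; exact: expR_ge0.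
rewrite -EFinM /trisk; congr (_ * ln (_ * _))%:E.
by apply: eq_bigr => i _; rewrite tnth_mktuple.
Qed.

Variables (alpha : R) (N : nat).
Hypotheses (alpha0 : 0 < alpha) (N0 : (0 < N)%N).
Implicit Types x y : N.-tuple R.

Let NR : 0 < N%:R :> R. Proof. by rewrite ltr0n. Qed.

Lemma tuple_average_gt0 (f : R -> R) x : (forall a, 0 < f a) ->
  0 < N%:R^-1 * \sum_(i < N) f (tnth x i).
Proof.
move=> f0; rewrite mulr_gt0 ?invr_gt0//.
rewrite (bigD1 (Ordinal N0))//= ltr_pwDl// sumr_ge0// => i _; exact: ltW.
Qed.

Lemma trisk_le x (U : R) : (forall i, tnth x i <= U) -> trisk alpha x <= U.
Proof.
move=> xU; rewrite /trisk ler_pdivrMl//.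
rewrite -[leRHS]expRK ler_ln ?posrE ?expR_gt0//; last first.
  by apply: (tuple_average_gt0 x (f := fun a => expR (alpha * a))) => a; exact: expR_gt0.
rewrite ler_pdivrMl// mulr_natl -[X in _ *+ X]card_ord -sumr_const.
by apply: ler_sum => i _; rewrite ler_expR ler_pM2l.
Qed.

Lemma trisk_ge x (L : R) : (forall i, L <= tnth x i) -> L <= trisk alpha x.
Proof.
move=> Lx; rewrite /trisk ler_pdivlMl//.
rewrite -[leLHS]expRK ler_ln ?posrE ?expR_gt0//; last first.
  by apply: (tuple_average_gt0 x (f := fun a => expR (alpha * a))) => a; exact: expR_gt0.
rewrite ler_pdivlMl// mulr_natl -[X in _ *+ X]card_ord -sumr_const.
by apply: ler_sum => i _; rewrite ler_expR ler_pM2l.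
Qed.

(** Jensen's inequality: the exponential lies above its tangent at the
    average. *)
Lemma tmean_le_trisk x : tmean x <= trisk alpha x.
Proof.
rewrite /trisk ler_pdivlMl//.
rewrite -[leLHS]expRK ler_ln ?posrE ?expR_gt0//; last first.
  by apply: (tuple_average_gt0 x (f := fun a => expR (alpha * a))) => a; exact: expR_gt0.
rewrite ler_pdivlMl//.
apply: (@le_trans _ _ (\sum_(i < N)
    expR (alpha * tmean x) * (1 + alpha * (tnth x i - tmean x)))).
  rewrite -mulr_sumr big_split /= sumr_const card_ord -mulr_sumr sumrB.
  rewrite sumr_const card_ord -[tmean x *+ _]mulr_natl /tmean mulVKf ?gt_eqF//.
  by rewrite subrr mulr0 addr0 mulrC.
apply: ler_sum => i _.
have -> : alpha * tnth x i =
  alpha * tmean x + alpha * (tnth x i - tmean x) by ring.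
rewrite expRD.
by rewrite ler_pM2l ?expR_gt0// expR_ge1Dx.
Qed.

Lemma risk_gapE (Q : probability R R) y :
  risk_gap alpha Q y = (entropic_risk alpha Q idfun - (trisk alpha y)%:E)%E.
Proof.
rewrite /risk_gap (entropic_risk_empirical _ _ N0 (@measurable_id _ _ setT)).
rewrite (_ : [tuple idfun (nth 0 y i) | i < N] = y)//.
by apply: eq_from_tnth => i; rewrite tnth_mktuple (tnth_nth 0).
Qed.

Lemma measurable_risk_gap (Q : probability R R) :
  measurable_fun setT (fun y : N.-tuple R => risk_gap alpha Q y).
Proof.
rewrite (_ : (fun _ => _) =
    (fun y => entropic_risk alpha Q idfun - (trisk alpha y)%:E)%E).
  apply: emeasurable_funB; first exact: measurable_cst.
  by apply/measurable_EFinP; exact: measurable_trisk.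
by apply/funext => y; rewrite risk_gapE.
Qed.

(** The empirical exponential moment exceeds three times its expectation with
    probability at most one third. *)
Lemma risk_gap_median_ge (Q : probability R R) (m : \bar R) :
  is_median (iid_law Q N) (@risk_gap R alpha Q N) m ->
  ((- (alpha^-1 * ln 3))%:E <= m)%E.
Proof.
move=> med; have [Qoo|Qoo] := eqVneq (\int[Q]_y (expR (alpha * y))%:E)%E +oo%E.
  apply: (median_ge (measurable_risk_gap Q) med measurableT).
    by rewrite probability_setT lte_fin invf_lt1// ltr1n.
  move=> y _; rewrite risk_gapE /entropic_risk Qoo /=.
  by rewrite gt0_muley ?lte_fin ?invr_gt0// leey.
have Q0 : (0 <= \int[Q]_y (expR (alpha * y))%:E)%E.
  by apply: integral_ge0 => y _; rewrite lee_fin expR_ge0.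
have [e eE] : exists e, (\int[Q]_y (expR (alpha * y))%:E = e%:E)%E.
  by exists (fine (\int[Q]_y (expR (alpha * y))%:E)%E); rewrite fineK// ge0_fin_numE// ltey.
have e0 : 0 < e.
  rewrite -lte_fin -eE; apply: probability_integral_gt0 => [|y]; last exact: expR_gt0.
  exact: measurable_expRM.
pose A := [set y : N.-tuple R | N%:R^-1 * \sum_(i < N) expR (alpha * tnth y i) < 3 * e].
have mavg := @measurable_tuple_sum N _ (measurable_expRM alpha).
have mA : measurable A.
  exact: (measurable_ltr_set mavg (measurable_cst _)).
apply: (median_ge (measurable_risk_gap Q) med mA).
  have : ((1 - e / (3 * e))%:E <= iid_law Q N A)%E.
    apply: probability_lt_ge => //; first by rewrite mulr_gt0.
      by move=> y; apply: ltW; apply: (tuple_average_gt0 y (f := fun a => expR (alpha * a))) => a; exact: expR_gt0.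
    under eq_integral do rewrite EFinM.
    rewrite ge0_integralZl//; last 2 first.
    - apply/measurable_EFinP; apply: measurable_sum => i.
      by apply: (measurableT_comp (measurable_expRM alpha)); exact: measurable_tnth.
    - by move=> y _; rewrite lee_fin; apply: sumr_ge0 => i _; exact: expR_ge0.
    rewrite (iid_law_integral_sum Q N (f := fun a => expR (alpha * a))); last 2 first.
    - by move=> y; exact: expR_ge0.
    - exact: measurable_expRM.
    by rewrite eE -!EFinM mulKf ?gt_eqF.
  apply: lt_le_trans; rewrite lte_fin invfM mulrCA divff ?gt_eqF// mulr1; lra.
move=> y Ay; rewrite risk_gapE (entropic_risk_EFin e0 eE) -EFinB lee_fin.
have avg0 := tuple_average_gt0 y (f := fun a => expR (alpha * a))
  (fun a => expR_gt0 _).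
have : ln (N%:R^-1 * \sum_(i < N) expR (alpha * tnth y i)) <= ln 3 + ln e.
  have {}Ay : N%:R^-1 * \sum_(i < N) expR (alpha * tnth y i) < 3 * e := Ay.
  by rewrite -lnM ?posrE// ler_ln ?posrE ?avg0 ?mulr_gt0//; exact: ltW.
rewrite /trisk -mulrBr -mulrN ler_pM2l ?invr_gt0//; lra.
Qed.

End tuple_statistics.

Section median_tails.
Context {R : realType} (alpha : R) (N : nat) (Q : probability R R) (m : \bar R).
Hypotheses (alpha0 : 0 < alpha) (N0 : (0 < N)%N)
  (med : is_median (iid_law Q N) (@risk_gap R alpha Q N) m).

Let NR : 0 < N%:R :> R. Proof. by rewrite ltr0n. Qed.

(* by Bernoulli's inequality the event fails with probability at most 1/4, and
   medians require less than 1/2 *)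
Let all_draws (B : set R) : measurable B ->
  ((1 - (4 * N%:R)^-1)%:E <= Q B)%E ->
  measurable [set y : N.-tuple R | forall i, B (tnth y i)] /\
  ((2^-1)%:E < iid_law Q N [set y | forall i, B (tnth y i)])%E.
Proof.
move=> mB QB; split.
  rewrite (_ : [set y | _] = \bigcap_(i in [set: 'I_N])
     ((fun x : N.-tuple R => tnth x i) @^-1` B)).
    apply: fin_bigcap_measurable => // i _; rewrite -[_ @^-1` _]setTI.
    exact: measurable_tnth.
  by apply/seteqP; split=> [x h i _|x h i]; [exact: h|exact: h].
have e0 : 0 <= (4 * N%:R)^-1 :> R by rewrite invr_ge0 mulr_ge0.
apply: lt_le_trans (iid_law_forall_ge N e0 mB QB).
rewrite lte_fin invfM mulrCA divff ?gt_eqF// mulr1; lra.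
Qed.

(** The entropic risk of a sample is at most its maximum, so a high quantile of
    the law bounds the empirical risk on more than half of the draws. *)
Lemma risk_gap_median_ge_sub (r U : R) :
  (r%:E <= entropic_risk alpha Q idfun)%E ->
  ((1 - (4 * N%:R)^-1)%:E <= Q [set y | (y <= U)%R])%E -> ((r - U)%:E <= m)%E.
Proof.
move=> rQ QU.
have mB : measurable [set y : R | y <= U].
  exact: (measurable_ler_set (@measurable_id _ _ setT) (measurable_cst U)).
have [mA PA] := all_draws mB QU.
apply: (median_ge (measurable_risk_gap alpha N0 Q) med mA PA) => y yU.
rewrite risk_gapE// EFinB leeB// lee_fin; exact: trisk_le.
Qed.

Lemma risk_gap_median_le_sub (r L : R) :
  (entropic_risk alpha Q idfun <= r%:E)%E ->
  ((1 - (4 * N%:R)^-1)%:E <= Q [set y | (L <= y)%R])%E -> (m <= (r - L)%:E)%E.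
Proof.
move=> rQ QL.
have mB : measurable [set y : R | L <= y].
  exact: (measurable_ler_set (measurable_cst L) (@measurable_id _ _ setT)).
have [mA PA] := all_draws mB QL.
apply: (median_le (measurable_risk_gap alpha N0 Q) med mA PA) => y yL.
rewrite risk_gapE// EFinB leeB// lee_fin; exact: trisk_ge.
Qed.

(** The relative error of the empirical exponential moment is a mean of
    centred independent variables, so Chebyshev's inequality with fourth
    moments makes it smaller than [eps] with probability more than one half. *)
Lemma risk_gap_median_small (e K eps : R) : 0 < e ->
  (\int[Q]_y (expR (alpha * y))%:E = e%:E)%E ->
  (\int[Q]_y ((expR (alpha * y) / e) ^+ 4)%:E <= K%:E)%E ->
  0 < eps <= 2^-1 -> 48 * (K + 1) < N%:R ^+ 2 * eps ^+ 4 ->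
  (`|m| <= (2 * eps / alpha)%:E)%E.
Proof.
move=> e0 eE eK /andP[eps0 eps2] KN.
pose h y := expR (alpha * y) / e - 1.
have mW : measurable_fun setT (fun y : R => expR (alpha * y) / e).
  by apply: measurable_funM; [exact: measurable_expRM|exact: measurable_cst].
have mh : measurable_fun setT h by apply: measurable_funB => //; exact: measurable_cst.
have intexp : Q.-integrable setT (EFin \o (fun y => expR (alpha * y))).
  apply/integrableP; split; first by apply/measurable_EFinP; exact: measurable_expRM.
  under eq_integral do rewrite /= ger0_norm ?expR_ge0//.
  by rewrite eE ltry.
have h1 : (\int[Q]_y (h y)%:E = 0)%E.
  transitivity (\int[Q]_y (e^-1%:E * (expR (alpha * y))%:E - 1%:E))%E.
    by apply: eq_integral => y _; rewrite /h EFinB EFinM muleC.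
  rewrite integralB//; last 2 first.
  - exact: (integrableZl measurableT e^-1 intexp).
  - exact: finite_measure_integrable_cst.
  rewrite integralZl// eE -EFinM mulVf ?gt_eqF//.
  by rewrite integral_cst//= probability_setT mule1 subee.
have h4 : (\int[Q]_y (h y ^+ 4)%:E <= (8 * (K + 1))%:E)%E.
  apply: (@le_trans _ _ (\int[Q]_y (8%:E * ((expR (alpha * y) / e) ^+ 4)%:E + 8%:E)))%E.
    apply: ae_le_integral_measurable.
    - by apply/measurable_EFinP; exact: measurable_funX.
    - apply: emeasurable_funD; last exact: measurable_cst.
      apply: measurable_funeM; apply/measurable_EFinP; exact: measurable_funX.
    - apply: aeW => y; rewrite -EFinM -EFinD lee_fin /h.
      move: (expR _ / e) => a.
      have : 0 <= (a ^+ 2 - 1) ^+ 2 by exact: sqr_ge0.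
      have : 0 <= (a + 1) ^+ 4 by rewrite exprn_even_ge0.
      have : 0 <= (a + 1) ^+ 2 by exact: sqr_ge0.
      have : 0 <= (a - 1) ^+ 2 by exact: sqr_ge0.
      nra.
  rewrite ge0_integralD//; last 2 first.
  - by move=> y _; rewrite -EFinM lee_fin mulr_ge0// exprn_even_ge0.
  - apply: measurable_funeM; apply/measurable_EFinP; exact: measurable_funX.
  rewrite integral_cst//= probability_setT mule1.
  have -> : 8 * (K + 1) = 8 * K + 8 by ring.
  rewrite [in leRHS]EFinD; apply: leeD => //.
  rewrite ge0_integralZl//; last 2 first.
  - by apply/measurable_EFinP; exact: measurable_funX.
  - by move=> y _; rewrite lee_fin exprn_even_ge0.
  by rewrite EFinM lee_pmul2l.
pose S (y : N.-tuple R) := \sum_(i < N) h (tnth y i).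
have mS : measurable_fun setT S.
  apply: measurable_sum => i; apply: measurableT_comp => //.
  exact: measurable_tnth.
have c0 : 0 < (N%:R * eps) ^+ 4 by rewrite exprn_gt0// mulr_gt0.
pose A := [set y | S y ^+ 4 < (N%:R * eps) ^+ 4].
have mA : measurable A.
  by apply: measurable_ltr_set; [exact: measurable_funX|exact: measurable_cst].
have S40 y : 0 <= S y ^+ 4 by rewrite exprn_even_ge0.
have PA : ((2^-1)%:E < iid_law Q N A)%E.
  have := probability_lt_ge (P := iid_law Q N) c0 (measurable_funX 4 mS)
    S40 (iid_law_fourth_moment N mh h1 h4).
  apply: lt_le_trans; rewrite lte_fin ltrBrDr -ltrBrDl ltr_pdivrMr//.
  have N2 : 0 < N%:R ^+ 2 :> R by rewrite exprn_gt0.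
  have -> : (1 - 2^-1) * (N%:R * eps) ^+ 4 =
    N%:R ^+ 2 * ((N%:R ^+ 2 * eps ^+ 4) / 2) :> R by field.
  have -> : 3 * N%:R ^+ 2 * (8 * (K + 1)) = N%:R ^+ 2 * (24 * (K + 1)) by ring.
  rewrite ltr_pM2l//; lra.
have bound y : A y -> ((- (2 * eps / alpha))%:E <= risk_gap alpha Q y)%E /\
    (risk_gap alpha Q y <= (2 * eps / alpha)%:E)%E.
  move=> Ay; rewrite risk_gapE// (entropic_risk_EFin e0 eE) -EFinB !lee_fin.
  apply/andP; rewrite -ler_norml.
  have Su : `|S y / N%:R| < eps.
    rewrite normrM normfV (ger0_norm (ltW NR)) ltr_pdivrMr// mulrC.
    rewrite -(@ltr_pXn2r _ 4)// ?nnegrE ?mulr_ge0// ?ltW//.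
    by rewrite -normrX ger0_norm ?exprn_even_ge0.
  have -> : trisk alpha y = alpha^-1 * ln (e * (1 + S y / N%:R)).
    rewrite /trisk; congr (_ * ln _).
    rewrite /S sumrB sumr_const card_ord -mulr_suml -[1 *+ N]mulr_natl.
    by field; rewrite !gt_eqF.
  move: Su; set u := S y / N%:R => Su.
  have [u1 u2] : - eps < u /\ u < eps by apply/andP; rewrite -ltr_norml.
  have u3 : 0 < 1 + u by lra.
  rewrite lnM ?posrE// -mulrBr opprD addNKr mulrN normrN normrM.
  rewrite (ger0_norm (ltW _)) ?invr_gt0// mulrC ler_pM2r ?invr_gt0//.
  rewrite ler_norml; apply/andP; split; last first.
    by apply: (@le_trans _ _ u); [apply: le_ln1Dx; lra|lra].
  have : ln (1 + ((1 + u)^-1 - 1)) <= (1 + u)^-1 - 1.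
    by apply: le_ln1Dx; rewrite ltrBrDl subrr invr_gt0.
  rewrite addrC subrK lnV ?posrE// => lnu.
  have : (1 + u)^-1 <= 1 + 2 * eps.
    rewrite -[(1 + u)^-1]mul1r ler_pdivrMr//; nra.
  lra.
have lo : ((- (2 * eps / alpha))%:E <= m)%E.
  apply: (median_ge (measurable_risk_gap alpha N0 Q) med mA PA).
  by move=> y /bound[].
have hi : (m <= (2 * eps / alpha)%:E)%E.
  apply: (median_le (measurable_risk_gap alpha N0 Q) med mA PA).
  by move=> y /bound[].
move: lo hi; case: m => [r| |]//; rewrite !lee_fin => lo hi.
by rewrite ler_norml lo.
Qed.

End median_tails.

(** * Exponential moments from tail bounds *)

(** The exponential lies above its tangent at the mean. *)
Lemma expR_jensen {d} {T : measurableType d} {R : realType}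
    (P : probability T R) (X : T -> R) (a m : R) :
  P.-integrable setT (EFin \o X) -> (\int[P]_t (X t)%:E = m%:E)%E ->
  ((expR (a * m))%:E <= \int[P]_t (expR (a * X t))%:E)%E.
Proof.
move=> intX Xm.
have mX : measurable_fun setT X by apply/measurable_EFinP; exact: (measurable_int _ intX).
pose c (k : 'I_2) := [:: expR (a * m) * (1 - a * m); expR (a * m) * a]`_k.
pose f (k : 'I_2) (t : T) := X t ^+ k.
have intf k : P.-integrable setT (EFin \o f k).
  by case: k => [[|[|k]] kP]//; exact: finite_measure_integrable_cst.
apply: (@le_trans _ _ (\int[P]_t (\sum_k c k * f k t)%:E)%E).
  rewrite integral_lincomb// !big_ord_recr big_ord0 /= add0r /f /=.
  under eq_integral do rewrite expr0.
  rewrite integral_cst//= mul1e probability_setT Xm /c /= lee_fin.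
  by rewrite le_eqVlt; apply/orP; left; apply/eqP; ring.
apply: ae_le_integral_measurable.
- apply/measurable_EFinP; apply: measurable_sum => k.
  apply: measurable_funM; first exact: measurable_cst.
  exact: measurable_funX.
- by apply/measurable_EFinP; exact: (measurableT_comp (measurable_expRM a)).
apply: aeW => t; rewrite lee_fin !big_ord_recr big_ord0 /= add0r /c /f /= expr0 mulr1.
have -> : a * X t = a * m + a * (X t - m) by ring.
rewrite expRD; apply: (@le_trans _ _ (expR (a * m) * (1 + a * (X t - m)))).
  by rewrite le_eqVlt; apply/orP; left; apply/eqP; ring.
by rewrite ler_pM2l ?expR_gt0// expR_ge1Dx.
Qed.

Section exponential_moments.
Context {R : realType}.

(** The tail is summed over the integers, against the weights
    [exp (L / 4 (n + 1)^2)]; since [(n + 1)^2 <= 2 n^2 + 2], half of the decay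
    survives and the series is dominated by a geometric one. The bound depends
    on the tail constants only, which makes it uniform over distributions. *)
Lemma exp_square_moment (G L : R) : 0 < G -> 0 < L ->
  exists2 K : R, 0 < K & forall d (T : measurableType d) (P : probability T R)
    (X : T -> R), measurable_fun setT X ->
    (forall n, P [set t | n%:R <= `|X t|]%R <=
      (G * expR (- (L * n%:R ^+ 2)))%:E)%E ->
    (\int[P]_t (expR (L / 4 * X t ^+ 2))%:E <= K%:E)%E.
Proof.
move=> G0 L0; pose a := G * expR (L / 2); pose q := expR (- (L / 2)).
have q1 : q < 1 by rewrite expR_lt1 oppr_lt0 divr_gt0.
have q0 : 0 < q by exact: expR_gt0.
exists (a * (1 - q)^-1).
  by rewrite mulr_gt0 ?mulr_gt0 ?expR_gt0// invr_gt0 subr_gt0.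
move=> d T P X mX tail.
pose A n := [set t | n%:R <= `|X t|].
have mA n : measurable (A n).
  by apply: measurable_ler_set; [exact: measurable_cst|exact: measurableT_comp].
pose f n t : \bar R := ((expR (L / 4 * (n.+1)%:R ^+ 2))%:E * (\1_(A n) t)%:E)%E.
have mf n : measurable_fun setT (f n).
  by apply: measurable_funeM; apply/measurable_EFinP; exact: measurable_indic.
have f0 n t : (0 <= f n t)%E by rewrite mule_ge0// lee_fin ?expR_ge0.
apply: (@le_trans _ _ (\int[P]_t \sum_(0 <= n <oo) f n t)%E).
  apply: ae_le_integral_measurable.
  - apply/measurable_EFinP; apply: (measurableT_comp (@measurable_expR R)
      (g := fun t => L / 4 * X t ^+ 2)).
    by apply: measurable_funM; [exact: measurable_cst|exact: measurable_funX].
  - exact: ge0_emeasurable_sum.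
  apply: aeW => t.
  pose n := Num.truncn `|X t|.
  have /andP[n1 n2] : n%:R <= `|X t| < n.+1%:R by exact: truncn_itv.
  apply: (@le_trans _ _ (f n t)).
    rewrite /f indicE mem_set// mule1 lee_fin ler_expR ler_pM2l ?divr_gt0//.
    by rewrite -real_normK ?num_real// lerXn2r ?nnegrE// ltW.
  rewrite -[leLHS]adde0.
  apply: (@le_trans _ _ (\sum_(0 <= k < n.+1) f k t)%E).
    by rewrite big_nat_recr//= addeC leeD2r// sume_ge0.
  by apply: nneseries_lim_ge => k _ _.
rewrite integral_nneseries//.
apply: lime_le; first by apply: is_cvg_nneseries => k _ _; exact: integral_ge0.
apply: nearW => n.
apply: (@le_trans _ _ (\sum_(0 <= k < n) (a * q ^+ k)%:E)%E).
  apply: lee_sum => k _.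
  rewrite /f ge0_integralZl//; last first.
    by apply/measurable_EFinP; exact: measurable_indic.
  rewrite integral_indic// setIT.
  apply: (@le_trans _ _ ((expR (L / 4 * k.+1%:R ^+ 2))%:E *
      (G * expR (- (L * k%:R ^+ 2)))%:E)%E).
    by rewrite lee_pmul2l ?lte_fin ?expR_gt0//; exact: tail.
  rewrite -EFinM lee_fin mulrCA -expRD.
  have -> : a * q ^+ k = G * expR (L / 2 + k%:R * - (L / 2)).
    by rewrite /a /q -expRM_natl expRD mulrA.
  rewrite ler_pM2l// ler_expR -[k.+1%:R]natr1.
  have kk : k%:R <= k%:R ^+ 2 :> R.
    by rewrite -natrX ler_nat; case: (k) => // j; rewrite expnS leq_pmulr// expn_gt0.
  have h1 : 0 <= L * (k%:R ^+ 2 - k%:R) by rewrite mulr_ge0 ?subr_ge0// ltW.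
  have h2 : 0 <= L * (k%:R - 1) ^+ 2 by rewrite mulr_ge0 ?sqr_ge0// ltW.
  move: h1 h2; move: (k%:R : R) => x h1 h2; clear -h1 h2.
  lra.
rewrite sumEFin lee_fin.
have := @geometric_le_lim R n a q; rewrite ltW ?mulr_gt0 ?expR_gt0//.
by apply=> //; rewrite ger0_norm// ltW.
Qed.

Lemma exp_linear_moment {d} {T : measurableType d} (P : probability T R)
    (X : T -> R) (L K t : R) : 0 < L -> measurable_fun setT X ->
  (\int[P]_x (expR (L / 4 * X x ^+ 2))%:E <= K%:E)%E ->
  (\int[P]_x (expR (t * X x))%:E <= (K * expR (t ^+ 2 / L))%:E)%E.
Proof.
move=> L0 mX XK.
have m2 : measurable_fun setT (fun x => (expR (L / 4 * X x ^+ 2))%:E).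
  apply/measurable_EFinP; apply: (measurableT_comp (@measurable_expR R)
    (g := fun t => L / 4 * X t ^+ 2)).
  by apply: measurable_funM; [exact: measurable_cst|exact: measurable_funX].
apply: (@le_trans _ _ (\int[P]_x ((expR (t ^+ 2 / L))%:E *
    (expR (L / 4 * X x ^+ 2))%:E))%E).
  apply: ae_le_integral_measurable.
  - by apply/measurable_EFinP; exact: (measurableT_comp (measurable_expRM t)).
  - exact: measurable_funeM.
  apply: aeW => x; rewrite -EFinM lee_fin -expRD ler_expR.
  rewrite -subr_ge0.
  have -> : t ^+ 2 / L + L / 4 * X x ^+ 2 - t * X x = (t - L * X x / 2) ^+ 2 / L.
    by field; rewrite gt_eqF.
  by rewrite divr_ge0 ?sqr_ge0// ltW.
rewrite ge0_integralZl//.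
by rewrite [K * _]mulrC EFinM lee_pmul2l ?lte_fin ?expR_gt0.
Qed.

(** For [n] beyond [(L / C)^(1 / (q - 2))] the exponent [C n^q] dominates
    [L n^2]; before that, probabilities are at most one. *)
Lemma lighter_than_gaussian_tail {d} {T : measurableType d}
    (P : probability T R) (X : T -> R) (L : R) : 0 < L ->
  lighter_than_gaussian P X -> measurable_fun setT X ->
  exists2 G : R, 0 < G & forall n, (P [set t | n%:R <= `|X t|]%R <=
    (G * expR (- (L * n%:R ^+ 2)))%:E)%E.
Proof.
move=> L0 [q [G [C [q2 G0 C0 tail]]]] mX.
pose n0 := (L / C) `^ (q - 2)^-1.
have q20 : 0 < q - 2 by rewrite subr_gt0.
have n00 : 0 < n0 by rewrite powR_gt0// divr_gt0.
exists (G + expR (L * n0 ^+ 2)); first by rewrite addr_gt0 ?expR_gt0.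
move=> n; have [nn|nn] := leP n0 n%:R.
  apply: (le_trans (tail n%:R (ler0n _ _))); rewrite lee_fin.
  apply: (@le_trans _ _ (G * expR (- (L * n%:R ^+ 2)))); last first.
    by rewrite ler_pM2r ?expR_gt0// lerDl expR_ge0.
  rewrite ler_pM2l// ler_expR lerN2.
  have n1 : 0 < n%:R :> R by exact: lt_le_trans nn.
  have -> : n%:R `^ q = n%:R ^+ 2 * n%:R `^ (q - 2) :> R.
    rewrite -powR_mulrn ?ler0n// -powRD ?(gt_eqF n1) ?implybT//.
    by congr (_ `^ _); ring.
  rewrite [leRHS]mulrCA [leLHS]mulrC ler_pM2l ?exprn_gt0//.
  have : L / C <= n%:R `^ (q - 2).
    have -> : L / C = n0 `^ (q - 2).
      by rewrite /n0 -powRrM mulVf ?gt_eqF// powRr1// ltW// divr_gt0.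
    by apply: ge0_ler_powR; rewrite ?nnegrE// ltW.
  by rewrite ler_pdivrMr// mulrC.
apply: (@le_trans _ _ 1%E).
  apply: probability_le1; apply: measurable_ler_set; first exact: measurable_cst.
  exact: measurableT_comp.
rewrite lee_fin mulrDl -expRD; apply: ler_wpDl.
  by rewrite mulr_ge0 ?expR_ge0// ltW.
rewrite -[leLHS]expR0 ler_expR -mulrBr mulr_ge0 ?ltW// subr_gt0.
by rewrite ltr_pXn2r// nnegrE// ltW//.
Qed.

Lemma lighter_than_gaussian_exp_square {d} {T : measurableType d}
    (P : probability T R) (X : T -> R) (k : R) : 0 < k ->
  lighter_than_gaussian P X -> measurable_fun setT X ->
  exists K : R, (\int[P]_t (expR (k * X t ^+ 2))%:E <= K%:E)%E.
Proof.
move=> k0 lX mX; have k40 : 0 < 4 * k by rewrite mulr_gt0.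
have [G G0 tail] := lighter_than_gaussian_tail k40 lX mX.
have [K _ KP] := exp_square_moment G0 k40; exists K.
have := KP _ _ _ _ mX tail.
by under eq_integral do rewrite [4 * k]mulrC mulfK//.
Qed.

End exponential_moments.

(** * The strong law of large numbers *)

Lemma mutually_independent_comp {d1 d2 d3} {Omega : measurableType d1}
    {T : measurableType d2} {U : measurableType d3} {R : realType}
    (P : probability Omega R) (X : nat -> Omega -> T) (f : T -> U) :
  measurable_fun setT f -> mutually_independent P X ->
  mutually_independent P (fun i => f \o X i).
Proof.
move=> mf indX J B mB; have mfB i : measurable (f @^-1` B i).
  by rewrite -[_ @^-1` _]setTI; exact: mf.
exact: (indX J _ mfB).
Qed.

Section strong_law.
Context {d} {Omega : measurableType d} {R : realType}
  (P : probability Omega R) (X : nat -> Omega -> R) (Q : probability R R).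
Hypotheses (mX : forall i, measurable_fun setT (X i))
  (indX : mutually_independent P X)
  (XQ : forall i B, measurable B -> P (X i @^-1` B) = Q B).

Lemma sample_tuple_integral N (f : N.-tuple R -> \bar R) :
  measurable_fun setT f -> (forall x, 0 <= f x)%E ->
  (\int[P]_w f (sample_tuple X N w) = \int[iid_law Q N]_x f x)%E.
Proof.
move=> mf f0.
have mS := measurable_sample_tuple mX (N := N).
transitivity (\int[pushforward P (sample_tuple X N)]_x f x)%E.
  by rewrite ge0_integral_pushforward.
by apply: eq_measure_integral => A mA _; exact: sample_tuple_law.
Qed.

Lemma inv_square_series_le n :
  \sum_(0 <= k < n.+1) (k%:R ^- 2) <= 2 - n%:R^-1 *+ (0 < n)%N :> R.
Proof.
elim: n => [|n IH]; first by rewrite big_nat1 expr0n invr0 mulr0n subr0.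
rewrite big_nat_recr//=; case: n IH => [|n] IH.
  by rewrite big_nat1 expr0n invr0 add0r expr1n invr1 mulr1n; lra.
apply: (le_trans (lerD IH (lexx _))) => /=; rewrite !mulr1n.
rewrite -addrA lerD2l lerNr opprD opprK -[n.+2%:R]natr1.
have n0 : 0 < n.+1%:R :> R by rewrite ltr0n.
rewrite -subr_ge0; set x := n.+1%:R in n0 *.
have -> : x^-1 - (x + 1) ^- 2 - (x + 1)^-1 = (x * (x + 1) ^+ 2)^-1.
  by field; rewrite !gt_eqF// addr_gt0.
by rewrite invr_ge0 mulr_ge0 ?sqr_ge0// ltW.
Qed.

(** The fourth powers of the centred averages have summable expectations, so
    almost surely their series converges. *)
Lemma strong_law : (\int[Q]_y (y ^+ 4)%:E < +oo)%E ->
  {ae P, forall w, (n%:R^-1 * \sum_(i < n) X i w) @[n --> \oo] -->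
    fine (\int[Q]_y y%:E)%E}.
Proof.
move=> Q4; set mu := fine _.
have mid : measurable_fun setT (idfun : R -> R) by exact: measurable_id.
have intk k : (k <= 4)%N -> Q.-integrable setT (EFin \o (fun y => y ^+ k)).
  by move=> k4; exact: (integrable_powers (n := 2) k4 mid Q4).
have int1 : Q.-integrable setT (EFin \o (idfun : R -> R)).
  by have := intk 1 isT.
pose h (y : R) := y - mu.
have mh : measurable_fun setT h by apply: measurable_funB => //; exact: measurable_cst.
have h1 : (\int[Q]_y (h y)%:E = 0)%E.
  transitivity (\int[Q]_y (y%:E - mu%:E))%E; first exact: eq_integral.
  rewrite integralB//; last exact: finite_measure_integrable_cst.
  rewrite integral_cst//= probability_setT mule1 /mu fineK ?subee//;
    exact: (integrable_fin_num _ int1).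
have h4oo : (\int[Q]_y (h y ^+ 4)%:E < +oo)%E.
  pose c (k : nat) : R := nth 0 [:: mu ^+ 4; - 4 * mu ^+ 3; 6 * mu ^+ 2; - 4 * mu; 1] k.
  have -> : (\int[Q]_y (h y ^+ 4)%:E = \int[Q]_y (\sum_(k < 5) c k * y ^+ k)%:E)%E.
    apply: eq_integral => y _; congr EFin.
    by rewrite !big_ord_recr big_ord0 /= /c /h /=; ring.
  rewrite (@integral_lincomb _ _ _ Q _ (fun k : 'I_5 => c k)
    (fun k y => y ^+ k)) ?ltry// => k.
  by apply: intk; rewrite -ltnS.
pose m := fine (\int[Q]_y (h y ^+ 4)%:E)%E.
have hm : (\int[Q]_y (h y ^+ 4)%:E <= m%:E)%E.
  rewrite fineK// ge0_fin_numE//; apply: integral_ge0 => y _.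
  by rewrite lee_fin exprn_even_ge0.
have m0 : 0 <= m.
  by apply: fine_ge0; apply: integral_ge0 => y _; rewrite lee_fin exprn_even_ge0.
pose S n w := \sum_(i < n) h (X i w).
have mS n : measurable_fun setT (S n).
  by apply: measurable_sum => i; exact: measurableT_comp.
pose u n w := (S n w / n%:R) ^+ 4.
have u0 n w : 0 <= u n w by rewrite exprn_even_ge0.
have mu_ n : measurable_fun setT (EFin \o u n).
  apply/measurable_EFinP; apply: measurable_funX.
  by apply: measurable_funM => //; exact: measurable_cst.
have Eu n : (\int[P]_w (u n w)%:E <= (3 * m * n%:R ^- 2)%:E)%E.
  have -> : (\int[P]_w (u n w)%:E =
      \int[P]_w (((n%:R ^- 4)%:E) * (S n w ^+ 4)%:E))%E.
    by apply: eq_integral => w _; rewrite -EFinM /u exprMn exprVn mulrC.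
  have mS4 : measurable_fun setT (fun w => (S n w ^+ 4)%:E).
    by apply/measurable_EFinP; exact: measurable_funX.
  rewrite ge0_integralZl//; last first.
    by move=> w _; rewrite lee_fin exprn_even_ge0.
  have -> : (\int[P]_w (S n w ^+ 4)%:E =
      \int[iid_law Q n]_x ((\sum_(i < n) h (tnth x i)) ^+ 4)%:E)%E.
    rewrite -sample_tuple_integral.
    - apply: eq_integral => w _; congr (_ ^+ 4)%:E; apply: eq_bigr => i _.
      by rewrite tnth_mktuple.
    - apply/measurable_EFinP; apply: measurable_funX.
      apply: measurable_sum => i; apply: measurableT_comp => //.
      exact: measurable_tnth.
    - by move=> x; rewrite lee_fin exprn_even_ge0.
  apply: (@le_trans _ _ ((n%:R ^- 4)%:E * (3 * n%:R ^+ 2 * m)%:E)%E).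
    apply: lee_wpmul2l; first by rewrite lee_fin invr_ge0 exprn_ge0.
    exact: (iid_law_fourth_moment n mh h1 hm).
  rewrite -EFinM lee_fin; case: (n) => [|k]; first by rewrite !expr0n /= invr0 !mul0r !mulr0.
  have : k.+1%:R != 0 :> R by rewrite pnatr_eq0.
  move: (k.+1%:R : R) => x x0.
  by rewrite le_eqVlt; apply/orP; left; apply/eqP; field.
have ae_fin : {ae P, forall w, (\sum_(0 <= n <oo) (u n w)%:E < +oo)%E}.
  have intu : P.-integrable setT (fun w => \sum_(0 <= n <oo) (u n w)%:E)%E.
    apply/integrableP; split.
      by apply: ge0_emeasurable_sum => [k x _ _|k _]; [rewrite lee_fin|exact: mu_].
    under eq_integral.
      move=> w _; rewrite gee0_abs; last by apply: nneseries_ge0 => k _ _; rewrite lee_fin.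
      over.
    rewrite integral_nneseries//; last by move=> k w _; rewrite lee_fin.
    apply: (@le_lt_trans _ _ (3 * m * 2)%:E); last exact: ltry.
    apply: lime_le.
      by apply: is_cvg_nneseries => k _ _; apply: integral_ge0 => w _; rewrite lee_fin.
    apply: nearW => n.
    apply: (@le_trans _ _ (\sum_(0 <= k < n) (3 * m * k%:R ^- 2)%:E)%E).
      by apply: lee_sum => k _; exact: Eu.
    rewrite sumEFin lee_fin -mulr_sumr ler_wpM2l ?mulr_ge0//.
    case: n => [|n]; first by rewrite big_nil.
    apply: (le_trans (inv_square_series_le n)).
    by rewrite gerBl mulrn_wge0// invr_ge0.
  apply: filterS (integrable_ae measurableT intu) => w /(_ I).
  by rewrite fin_numElt => /andP[].
apply: filterS ae_fin => w uw.
have u_cvg : u n w @[n --> \oo] --> (0 : R).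
  apply: cvg_series_cvg_0; apply: nondecreasing_is_cvgn.
    apply/nondecreasing_seqP => n; rewrite /series /= big_nat_recr//= lerDl.
    exact: u0.
  exists (fine (\sum_(0 <= n <oo) (u n w)%:E)%E) => _ [n _ <-].
  rewrite -lee_fin fineK; last first.
    by rewrite ge0_fin_numE//; apply: nneseries_ge0 => k _ _; rewrite lee_fin.
  rewrite /series /= -sumEFin; apply: nneseries_lim_ge => k _ _.
  by rewrite lee_fin.
apply/cvgrPdist_lt => e e0.
have e4 : 0 < e ^+ 4 by rewrite exprn_gt0.
move/cvgrPdist_lt : u_cvg => /(_ _ e4) near_u.
near=> n.
have n0 : (0 < n)%N by near: n; exact: nbhs_infty_gt.
have nR : n%:R != 0 :> R by rewrite pnatr_eq0 -lt0n.
have : `|0 - u n w| < e ^+ 4 by near: n.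
rewrite sub0r normrN ger0_norm// /u.
have -> : S n w / n%:R = - (mu - n%:R^-1 * \sum_(i < n) X i w).
  rewrite /S /h sumrB sumr_const card_ord mulrBl -[mu *+ n]mulr_natl.
  by field.
move=> H; rewrite -(@ltr_pXn2r _ 4)// ?nnegrE ?ltW//.
rewrite -normrX ger0_norm ?exprn_even_ge0//.
by move: H; rewrite exprNn -signr_odd /= expr0 mul1r.
Unshelve. all: by end_near. Qed.

End strong_law.

(** * Correction terms of location-scale families *)

Section standardized.
Context {R : realType} (alpha : R) (N : nat) (Q Q' : probability R R) (m s : R).
Hypotheses (alpha0 : 0 < alpha) (N0 : (0 < N)%N) (s0 : 0 < s)
  (QQ' : forall B, measurable B -> Q ((fun y => (y - m) / s) @^-1` B) = Q' B).

Let measurable_scale : measurable_fun setT (fun u : R => m + s * u).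
Proof.
apply: measurable_funD; first exact: measurable_cst.
by apply: measurable_funM; [exact: measurable_cst|exact: measurable_id].
Qed.

Lemma standardized_same_law : same_law Q idfun Q' (fun u => m + s * u).
Proof.
move=> B mB; rewrite -QQ'; last by rewrite -[_ @^-1` _]setTI; exact: measurable_scale.
congr (Q _); apply/seteqP; split=> y /=.
  by rewrite mulrC divfK ?gt_eqF// addrC subrK.
by rewrite mulrC divfK ?gt_eqF// addrC subrK.
Qed.

Lemma standardized_integral (f : R -> \bar R) : measurable_fun setT f ->
  (\int[Q]_y f y = \int[Q']_u f (m + s * u)%R)%E.
Proof.
move=> mf; exact: (same_law_integral (@measurable_id _ _ setT)
  measurable_scale standardized_same_law mf).
Qed.

Lemma standardized_exp_moment (a : R) :
  (\int[Q]_y (expR (a * y))%:E =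
   (expR (a * m))%:E * \int[Q']_u (expR (a * s * u))%:E)%E.
Proof.
rewrite (standardized_integral (f := fun y => (expR (a * y))%:E)); last first.
  by apply/measurable_EFinP; exact: measurable_expRM.
have mexp : measurable_fun setT (fun u : R => (expR (a * s * u))%:E).
  by apply/measurable_EFinP; exact: measurable_expRM.
rewrite -ge0_integralZl//.
by apply: eq_integral => u _; rewrite -EFinM -expRD mulrDr mulrA.
Qed.

Let t := alpha * s.
Let t0 : 0 < t. Proof. exact: mulr_gt0. Qed.

(** The exponential moment is bounded below at the single integer threshold
    [n] just below [t c2^2 / 2], which maximizes [t n - n^2 / c2^2]. *)
Lemma heavy_tail_entropic_risk (c1 c2 abar : R) : 0 < c1 -> 0 < c2 ->
  (forall n, abar <= n%:R ->
    ((c1 * expR (- (n%:R ^+ 2 / c2 ^+ 2)))%:E <= Q' [set u | (n%:R <= u)%R])%E) ->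
  0 <= abar -> abar + 1 <= t * c2 ^+ 2 / 2 ->
  ((m + alpha^-1 * (ln c1 + t ^+ 2 * c2 ^+ 2 / 4 - t / 2))%:E <=
   entropic_risk alpha Q idfun)%E.
Proof.
move=> c10 c20 tail abar0 ht.
pose n := Num.truncn (t * c2 ^+ 2 / 2).
have c220 : 0 < c2 ^+ 2 by rewrite exprn_gt0.
have /andP[n1 n2] : n%:R <= t * c2 ^+ 2 / 2 < n.+1%:R.
  by apply: truncn_itv; rewrite divr_ge0// mulr_ge0 ?ltW.
have {}n2 : t * c2 ^+ 2 / 2 - 1 <= n%:R by rewrite lerBlDr natr1 ltW.
have an : abar <= n%:R by apply: le_trans n2; rewrite lerBrDr.
apply: entropic_risk_ge => //; rewrite (standardized_exp_moment alpha) -/t.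
have -> : alpha * (m + alpha^-1 * (ln c1 + t ^+ 2 * c2 ^+ 2 / 4 - t / 2)) =
    alpha * m + (ln c1 + t ^+ 2 * c2 ^+ 2 / 4 - t / 2).
  by field; rewrite gt_eqF.
rewrite expRD EFinM lee_pmul2l ?lte_fin ?expR_gt0//.
have mA : measurable [set u : R | n%:R <= u].
  by apply: measurable_ler_set; [exact: measurable_cst|exact: measurable_id].
apply: (@le_trans _ _ (\int[Q']_u ((expR (t * n%:R))%:E *
    (\1_[set u : R | n%:R <= u] u)%:E))%E); last first.
  apply: ae_le_integral_measurable.
  - by apply: measurable_funeM; apply/measurable_EFinP; exact: measurable_indic.
  - by apply/measurable_EFinP; exact: measurable_expRM.
  apply: aeW => u; rewrite -EFinM lee_fin indicE.
  have [/set_mem nu|_] := boolP (u \in _); last by rewrite mulr0 expR_ge0.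
  by rewrite mulr1 ler_expR ler_pM2l.
rewrite ge0_integralZl//; last by apply/measurable_EFinP; exact: measurable_indic.
rewrite integral_indic// setIT.
apply: (@le_trans _ _ ((expR (t * n%:R))%:E *
    (c1 * expR (- (n%:R ^+ 2 / c2 ^+ 2)))%:E)%E); last first.
  by rewrite lee_pmul2l ?lte_fin ?expR_gt0//; exact: tail.
rewrite -EFinM lee_fin -{2}(lnK c10) -!expRD ler_expR.
have -> : t * n%:R + (ln c1 - n%:R ^+ 2 / c2 ^+ 2) =
    ln c1 + n%:R * (t - n%:R / c2 ^+ 2) by field; rewrite gt_eqF.
suff : t ^+ 2 * c2 ^+ 2 / 4 - t / 2 <= n%:R * (t - n%:R / c2 ^+ 2).
  by move: (n%:R * _) (t ^+ 2 * c2 ^+ 2 / 4) => p q pq; lra.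
have t2 : t / 2 <= t - n%:R / c2 ^+ 2.
  rewrite lerBrDr addrC -lerBrDr ler_pdivrMr//.
  apply: (le_trans n1); rewrite le_eqVlt; apply/orP; left; apply/eqP; by field.
have n0 : 0 <= n%:R :> R by [].
apply: (@le_trans _ _ (n%:R * (t / 2))); last by rewrite ler_wpM2l.
have : 0 <= (n%:R - (t * c2 ^+ 2 / 2 - 1)) * t by rewrite mulr_ge0 ?subr_ge0// ltW.
lra.
Qed.

Variable delta : \bar R.
Hypothesis med : is_median (iid_law Q N) (@risk_gap R alpha Q N) delta.

Let measurable_std : measurable_fun setT (fun y : R => (y - m) / s).
Proof.
apply: measurable_funM; last exact: measurable_cst.
by apply: measurable_funB; [exact: measurable_id|exact: measurable_cst].
Qed.

(** More than half of the draws have an empirical risk that is linear in [t],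
    whereas the fitted risk is quadratic. As [t] is at least 1, the last
    hypothesis says that the linear and constant terms cost at most half of the
    quadratic one. *)
Lemma heavy_tail_median_ge (c1 c2 abar B : R) : 0 < c1 -> 0 < c2 ->
  (forall n, abar <= n%:R ->
    ((c1 * expR (- (n%:R ^+ 2 / c2 ^+ 2)))%:E <= Q' [set u | (n%:R <= u)%R])%E) ->
  0 <= abar -> 0 <= B ->
  ((1 - (4 * N%:R)^-1)%:E <= Q' [set u | (u <= B)%R])%E ->
  1 <= t -> abar + 1 <= t * c2 ^+ 2 / 2 ->
  2^-1 + B + `|ln c1| <= t * c2 ^+ 2 / 8 ->
  ((t ^+ 2 * c2 ^+ 2 / 8 / alpha)%:E <= delta)%E.
Proof.
move=> c10 c20 tail abar0 B0 QB t1 ht tB.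
have mB : measurable [set u : R | u <= B].
  by apply: measurable_ler_set; [exact: measurable_id|exact: measurable_cst].
have r := heavy_tail_entropic_risk c10 c20 tail abar0 ht.
have QU : ((1 - (4 * N%:R)^-1)%:E <= Q [set y | (y <= m + s * B)%R])%E.
  rewrite (_ : [set y | _] = (fun y => (y - m) / s) @^-1` [set u | u <= B]) ?QQ'//.
  by apply/seteqP; split=> y /=; rewrite ler_pdivrMr// lerBlDl [B * _]mulrC.
apply: le_trans (risk_gap_median_ge_sub alpha0 N0 med r QU).
rewrite lee_fin.
have -> : m + alpha^-1 * (ln c1 + t ^+ 2 * c2 ^+ 2 / 4 - t / 2) - (m + s * B) =
    (ln c1 + t ^+ 2 * c2 ^+ 2 / 4 - t / 2 - t * B) / alpha.
  by rewrite /t; field; rewrite gt_eqF.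
rewrite ler_pM2r ?invr_gt0//.
have : 0 <= (t - 1) * `|ln c1| by rewrite mulr_ge0 ?subr_ge0.
have : 0 <= t * (t * c2 ^+ 2 / 8 - (2^-1 + B + `|ln c1|)).
  by rewrite mulr_ge0 ?subr_ge0// ltW.
have : - `|ln c1| <= ln c1 by rewrite lerNl -normrN ler_norm.
lra.
Qed.

Variables (L K : R).
Hypotheses (L0 : 0 < L) (K0 : 0 < K)
  (QK : (\int[Q']_u (expR (L / 4 * u ^+ 2))%:E <= K%:E)%E).

Let exp_moment_le (a : R) : (\int[Q]_y (expR (a * y))%:E <=
  (expR (a * m) * (K * expR ((a * s) ^+ 2 / L)))%:E)%E.
Proof.
rewrite standardized_exp_moment EFinM lee_pmul2l ?lte_fin ?expR_gt0//.
exact: (exp_linear_moment (a * s) L0 (@measurable_id _ _ setT) QK).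
Qed.

(** Here the fitted risk is at most quadratic in [t], and more than half of the
    draws have an empirical risk above [m - s B]. *)
Lemma subgaussian_median_le (B : R) :
  ((1 - (4 * N%:R)^-1)%:E <= Q' [set u | (- B <= u)%R])%E ->
  (delta <= ((ln K + t ^+ 2 / L) / alpha + s * B)%:E)%E.
Proof.
move=> QB.
have mB : measurable [set u : R | - B <= u].
  by apply: measurable_ler_set; [exact: measurable_cst|exact: measurable_id].
have QL : ((1 - (4 * N%:R)^-1)%:E <= Q [set y | (m - s * B <= y)%R])%E.
  rewrite (_ : [set y | _] = (fun y => (y - m) / s) @^-1` [set u | - B <= u]) ?QQ'//.
  by apply/seteqP; split=> y /=; rewrite ler_pdivlMr// lerBrDl mulNr [B * _]mulrC.
have r : (entropic_risk alpha Q idfun <= (m + (ln K + t ^+ 2 / L) / alpha)%:E)%E.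
  apply: entropic_risk_le => //; apply: (le_trans (exp_moment_le alpha)).
  have -> : alpha * (m + (ln K + t ^+ 2 / L) / alpha) =
    alpha * m + (ln K + t ^+ 2 / L) by field; rewrite !gt_eqF.
  by rewrite !expRD lnK.
apply: (le_trans (risk_gap_median_le_sub alpha0 N0 med r QL)).
rewrite lee_fin; lra.
Qed.

(** Jensen's inequality bounds the exponential moment of a law with mean [m]
    below by [exp (alpha m)], so the relative fourth moment is controlled by
    the exponential moment of order [4 alpha]. *)
Lemma subgaussian_median_small (eps : R) : (\int[Q]_y y%:E = m%:E)%E ->
  0 < eps <= 2^-1 ->
  48 * (K * expR (16 * t ^+ 2 / L) + 1) < N%:R ^+ 2 * eps ^+ 4 ->
  (`|delta| <= (2 * eps / alpha)%:E)%E.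
Proof.
move=> Qm epsP hN.
pose I := (\int[Q]_y (expR (alpha * y))%:E)%E.
have I0 : (0 < I)%E.
  by apply: probability_integral_gt0 => [|y]; [exact: measurable_expRM|exact: expR_gt0].
have If : I \is a fin_num.
  by rewrite ge0_fin_numE ?(ltW I0)// (le_lt_trans (exp_moment_le alpha))// ltry.
have eE : I = (fine I)%:E by rewrite fineK.
have e0 : 0 < fine I by rewrite -lte_fin -eE.
have int1 : Q.-integrable setT (EFin \o (idfun : R -> R)).
  apply/integrableP; split; first by apply/measurable_EFinP; exact: measurable_id.
  apply: (@le_lt_trans _ _ (\int[Q]_y ((expR (1 * y))%:E + (expR (- 1 * y))%:E))%E).
    apply: ae_le_integral_measurable.
    - by apply/measurable_EFinP; apply: measurableT_comp => //; exact: measurable_id.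
    - by apply: emeasurable_funD; apply/measurable_EFinP; exact: measurable_expRM.
    apply: aeW => y; rewrite /= -EFinD lee_fin mul1r mulN1r.
    have h1 := expR_ge1Dx y; have h2 := expR_ge1Dx (- y).
    have h3 := expR_ge0 y; have h4 := expR_ge0 (- y).
    by rewrite ler_norml; apply/andP; split; lra.
  rewrite ge0_integralD//; last 2 first.
  - by apply/measurable_EFinP; exact: measurable_expRM.
  - by apply/measurable_EFinP; exact: measurable_expRM.
  by apply: lte_add_pinfty; apply: (le_lt_trans (exp_moment_le _)); exact: ltry.
have eJ : expR (alpha * m) <= fine I.
  by rewrite -lee_fin -eE; exact: (expR_jensen alpha int1 Qm).
apply: (risk_gap_median_small alpha0 N0 med e0 eE _ epsP hN).
have E4 : 0 < fine I ^+ 4 by rewrite exprn_gt0.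
have -> : (\int[Q]_y ((expR (alpha * y) / fine I) ^+ 4)%:E =
    \int[Q]_y ((fine I ^- 4)%:E * (expR (4 * alpha * y))%:E))%E.
  apply: eq_integral => y _; rewrite -EFinM; congr EFin.
  by rewrite exprMn exprVn mulrC -expRM_natl mulrA.
rewrite ge0_integralZl//; last 2 first.
- by apply/measurable_EFinP; exact: measurable_expRM.
- by rewrite lee_fin invr_ge0 ltW.
apply: (@le_trans _ _ ((fine I ^- 4)%:E *
    (expR (4 * alpha * m) * (K * expR ((4 * alpha * s) ^+ 2 / L)))%:E)%E).
  by apply: lee_wpmul2l; rewrite ?lee_fin ?invr_ge0 ?(ltW E4)//; exact: exp_moment_le.
rewrite -EFinM lee_fin mulrC ler_pdivrMr//.
have -> : (4 * alpha * s) ^+ 2 / L = 16 * t ^+ 2 / L.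
  by rewrite /t; congr (_ / _); ring.
rewrite mulrC ler_pM2l ?mulr_gt0 ?expR_gt0//.
rewrite -mulrA expRM_natl lerXn2r ?nnegrE ?expR_ge0// ltW//.
Qed.

End standardized.

(** * Standardized samples *)

Section standardize.
Context {R : realType}.
Implicit Types N : nat.

Definition affine_tuple (a b : R) N (x : N.-tuple R) : N.-tuple R :=
  map_tuple (fun y => a + b * y) x.

(** Written as an affine map with intercept and slope, the form in which
    equivariance applies to it. *)
Definition standardize N (x : N.-tuple R) : N.-tuple R :=
  affine_tuple (- tmean x / tsdev x) (tsdev x)^-1 x.

Lemma tmean_affine (a b : R) N (x : N.-tuple R) : (0 < N)%N ->
  tmean (affine_tuple a b x) = a + b * tmean x.
Proof.
move=> N0; have NR : N%:R != 0 :> R by rewrite pnatr_eq0 -lt0n.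
rewrite /tmean; under eq_bigr do rewrite tnth_map.
rewrite big_split /= sumr_const card_ord -mulr_sumr -[a *+ N]mulr_natl.
by field.
Qed.

Lemma tsdev_affine (a b : R) N (x : N.-tuple R) : (0 < N)%N -> 0 <= b ->
  tsdev (affine_tuple a b x) = b * tsdev x.
Proof.
move=> N0 b0; rewrite /tsdev tmean_affine//.
under eq_bigr do rewrite tnth_map.
have -> : N%:R^-1 * \sum_(i < N) (a + b * tnth x i - (a + b * tmean x)) ^+ 2 =
    b ^+ 2 * (N%:R^-1 * \sum_(i < N) (tnth x i - tmean x) ^+ 2).
  have -> : \sum_(i < N) (a + b * tnth x i - (a + b * tmean x)) ^+ 2 =
      b ^+ 2 * \sum_(i < N) (tnth x i - tmean x) ^+ 2.
    by rewrite mulr_sumr; apply: eq_bigr => i _; ring.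
  by rewrite mulrCA.
by rewrite sqrtrM ?sqr_ge0// sqrtr_sqr ger0_norm.
Qed.

Lemma standardize_affine (a b : R) N (x : N.-tuple R) : (0 < N)%N -> 0 < b ->
  standardize (affine_tuple a b x) = standardize x.
Proof.
move=> N0 b0; apply: eq_from_tnth => i; rewrite !tnth_map.
rewrite tmean_affine// tsdev_affine ?ltW// invfM.
have b1 : b^-1 * b = 1 by rewrite mulVf ?gt_eqF.
have -> : - (a + b * tmean x) * (b^-1 * (tsdev x)^-1) +
    b^-1 * (tsdev x)^-1 * (a + b * tnth x i) =
    (b^-1 * b) * ((tsdev x)^-1 * (tnth x i - tmean x)) by ring.
by rewrite b1; ring.
Qed.

Lemma sqr_tsdev_le N (x : N.-tuple R) : (0 < N)%N ->
  tsdev x ^+ 2 <= N%:R^-1 * \sum_(i < N) tnth x i ^+ 2.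
Proof.
move=> N0; have NR : 0 < N%:R :> R by rewrite ltr0n.
rewrite sqr_sqrtr; last first.
  by rewrite mulr_ge0 ?invr_ge0// sumr_ge0// => i _; exact: sqr_ge0.
have -> : \sum_(i < N) (tnth x i - tmean x) ^+ 2 =
    \sum_(i < N) tnth x i ^+ 2 - N%:R * tmean x ^+ 2.
  rewrite (eq_bigr (fun i => tnth x i ^+ 2 +
    (tmean x ^+ 2 - 2 * tmean x * tnth x i))); last by move=> i _; ring.
  rewrite big_split /= sumrB sumr_const card_ord -mulr_sumr.
  have -> : \sum_(i < N) tnth x i = N%:R * tmean x.
    by rewrite /tmean mulVKf// gt_eqF.
  by rewrite -[_ *+ N]mulr_natl; ring.
by rewrite ler_pM2l ?invr_gt0// gerBl mulr_ge0 ?sqr_ge0.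
Qed.

Lemma measurable_standardize N : measurable_fun setT (@standardize N).
Proof.
have minv : measurable_fun setT (fun x : N.-tuple R => (tsdev x)^-1).
  rewrite (_ : (fun _ => _) = (fun x => tsdev x `^ (-1))).
    by apply: (measurableT_comp (measurable_powR (- 1)%R)); exact: measurable_tsdev.
  by apply/funext => x; rewrite powR_inv1 // sqrtr_ge0.
apply/measurable_fun_tnthP => i.
rewrite (_ : _ \o _ = (fun x : N.-tuple R => - tmean x * (tsdev x)^-1 +
    (tsdev x)^-1 * tnth x i)); last first.
  by apply/funext => x /=; rewrite tnth_map.
apply: measurable_funD; apply: measurable_funM => //.
  by apply: measurable_funN; exact: measurable_tmean.
exact: measurable_tnth.
Qed.

Variable fit : forall N, N.-tuple R -> probability R R.
Hypothesis measurable_fit : forall N (B : set R), measurable B ->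
  measurable_fun setT (fun x : N.-tuple R => fit x B).

(** The tail conditions are kept at integer thresholds only, so that they hold
    on measurable sets of samples; these sets are invariant under positive
    affine maps. *)
Definition heavy_set N (c1 c2 abar : R) : set (N.-tuple R) :=
  [set x | 0 < tsdev x /\ forall n, abar <= n%:R ->
    ((c1 * expR (- (n%:R ^+ 2 / c2 ^+ 2)))%:E <=
     fit (standardize x) [set u | (n%:R <= u)%R])%E].

Definition subgaussian_set N (c3 : R) : set (N.-tuple R) :=
  [set x | 0 < tsdev x /\ forall n,
    (fit (standardize x) [set u | (n%:R <= `|u|)%R] <=
     (2 * expR (- (c3 ^- 2 * n%:R ^+ 2)))%:E)%E].

Lemma measurable_fit_standardize N (B : set R) : measurable B ->
  measurable_fun setT (fun x : N.-tuple R => fit (standardize x) B).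
Proof.
by move=> mB; apply: (measurableT_comp (measurable_fit mB)); exact: measurable_standardize.
Qed.

Lemma measurable_heavy_set N c1 c2 abar : measurable (@heavy_set N c1 c2 abar).
Proof.
rewrite (_ : heavy_set _ _ _ = [set x | 0 < tsdev x] `&`
  \bigcap_(n in [set n | abar <= n%:R])
    [set x : N.-tuple R | ((c1 * expR (- (n%:R ^+ 2 / c2 ^+ 2)))%:E <=
     fit (standardize x) [set u | (n%:R <= u)%R])%E]); last first.
  by apply/seteqP; split=> x [s0 h]; split=> // n an; exact: h.
apply: measurableI.
  by apply: measurable_ltr_set; [exact: measurable_cst|exact: measurable_tsdev].
apply: bigcap_measurableType => n _; apply: measurable_lee_set; first exact: measurable_cst.
apply: measurable_fit_standardize; apply: measurable_ler_set; first exact: measurable_cst.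
exact: measurable_id.
Qed.

Lemma measurable_subgaussian_set N c3 : measurable (@subgaussian_set N c3).
Proof.
rewrite (_ : subgaussian_set _ = [set x | 0 < tsdev x] `&`
  \bigcap_(n in setT)
    [set x : N.-tuple R | (fit (standardize x) [set u | (n%:R <= `|u|)%R] <=
     (2 * expR (- (c3 ^- 2 * n%:R ^+ 2)))%:E)%E]); last first.
  by apply/seteqP; split=> x [s0 h]; split=> // n; [move=> _; exact: h|exact: h].
apply: measurableI.
  by apply: measurable_ltr_set; [exact: measurable_cst|exact: measurable_tsdev].
apply: bigcap_measurableType => n _; apply: measurable_lee_set; last exact: measurable_cst.
apply: measurable_fit_standardize; apply: measurable_ler_set; first exact: measurable_cst.
exact: normr_measurable.
Qed.

Lemma heavy_set_affine N c1 c2 abar (a b : R) (x : N.-tuple R) :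
  (0 < N)%N -> 0 < b ->
  heavy_set c1 c2 abar (affine_tuple a b x) <-> heavy_set c1 c2 abar x.
Proof.
move=> N0 b0; rewrite /heavy_set /= standardize_affine// tsdev_affine ?ltW//.
by rewrite pmulr_rgt0.
Qed.

Lemma subgaussian_set_affine N c3 (a b : R) (x : N.-tuple R) :
  (0 < N)%N -> 0 < b ->
  subgaussian_set c3 (affine_tuple a b x) <-> subgaussian_set c3 x.
Proof.
move=> N0 b0; rewrite /subgaussian_set /= standardize_affine// tsdev_affine ?ltW//.
by rewrite pmulr_rgt0.
Qed.

End standardize.

(** * Decision problems *)

Section model.
Context {R : realType} (M : loss_model R) (z : 'rV[R]_(dim_z M)).
Hypothesis dz : decisions z.
Implicit Types (N : nat) (w : Omega M).

Definition loss_sample i w : R := loss M z (sample M i w).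

Lemma measurable_loss_sample i : measurable_fun setT (loss_sample i).
Proof. by apply: measurableT_comp; [exact: measurable_loss|exact: measurable_sample]. Qed.

Lemma loss_sample_independent : mutually_independent (Pr M) loss_sample.
Proof.
have h := mutually_independent_comp (measurable_loss dz) (@sample_independent R M).
exact: h.
Qed.

Lemma loss_sample_law i (B : set R) : measurable B ->
  Pr M (loss_sample i @^-1` B) = law M (loss M z @^-1` B).
Proof.
move=> mB; apply: (sample_law i (B := loss M z @^-1` B)).
by rewrite -[_ @^-1` _]setTI; exact: measurable_loss.
Qed.

Lemma muhatE N w : muhat z N w = tmean (scenarios z N w).
Proof.
rewrite /muhat /mean /Rintegral integral_empirical; last exact: measurable_loss.
by rewrite /tmean /=; congr (_ * _); apply: eq_bigr => i _; rewrite tnth_mktuple.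
Qed.

Lemma sigmahatE N w : sigmahat z N w = tsdev (scenarios z N w).
Proof.
rewrite /sigmahat /stddev /Rintegral -/(muhat z N w) muhatE.
rewrite (integral_empirical (f := fun x => (loss M z x - tmean (scenarios z N w)) ^+ 2)).
  rewrite /tsdev /=; congr (Num.sqrt (_ * _)); apply: eq_bigr => i _.
  by rewrite tnth_mktuple.
apply: measurable_funX; apply: measurable_funB; first exact: measurable_loss.
exact: measurable_cst.
Qed.

Lemma corrected_riskE alpha (delta : forall N, N.-tuple R -> \bar R) N w :
  (0 < N)%N -> corrected_risk z alpha delta N w =
  ((trisk alpha (scenarios z N w))%:E + delta N (scenarios z N w))%E.
Proof.
move=> N0; rewrite /corrected_risk /Phat entropic_risk_empirical//.
exact: measurable_loss.
Qed.

Variable fit : forall N, N.-tuple R -> probability R R.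

(** Equivariance with slope [1 / tsdev x], the slope that standardizes the
    sample. *)
Lemma fit_standardize N w (B : set R) : affine_equivariance z fit ->
  (1 < N)%N -> measurable B ->
  let x := scenarios z N w in
  fit x ((fun y => (y - tmean x) / tsdev x) @^-1` B) = fit (standardize x) B.
Proof.
move=> ae N1 mB x.
have s0 : 0 <= (tsdev x)^-1 by rewrite invr_ge0 sqrtr_ge0.
rewrite /standardize /affine_tuple -(ae N w _ _ N1 s0 B mB).
congr (fit x _); apply/seteqP; split=> y /=.
  by rewrite mulrBl mulNr addrC [y * _]mulrC.
by rewrite mulrBl mulNr addrC [y * _]mulrC.
Qed.

Lemma ae_heavy_set : sigmahat_gt0 z -> affine_equivariance z fit ->
  heavy_gaussian_right_tails z fit ->
  exists c1 c2 abar : R, [/\ 0 < c1, 0 < c2, 0 < abar & forall N, (1 < N)%N ->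
    {ae Pr M, forall w, heavy_set fit c1 c2 abar (scenarios z N w)}].
Proof.
move=> sp ae [c1 [c2 [abar [c10 c20 a0 tail]]]].
exists c1, c2, abar; split=> // N N1.
apply: filterS2 (sp N N1) (tail N N1) => w; rewrite sigmahatE muhatE => s0 tl.
split=> // n an; have := tl _ an.
have mB : measurable [set u : R | n%:R <= u].
  by apply: measurable_ler_set; [exact: measurable_cst|exact: measurable_id].
by rewrite -(fit_standardize w ae N1 mB).
Qed.

Lemma ae_subgaussian_set : sigmahat_gt0 z -> affine_equivariance z fit ->
  subgaussian_tails z fit ->
  exists2 c3 : R, 0 < c3 & forall N, (1 < N)%N ->
    {ae Pr M, forall w, subgaussian_set fit c3 (scenarios z N w)}.
Proof.
move=> sp ae [c3 c30 tail]; exists c3 => // N N1.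
apply: filterS2 (sp N N1) (tail N N1) => w; rewrite sigmahatE muhatE => s0 tl.
split=> // n; have := tl _ (ler0n _ n).
have mB : measurable [set u : R | n%:R <= `|u|].
  apply: measurable_ler_set; first exact: measurable_cst.
  exact: normr_measurable.
rewrite -(fit_standardize w ae N1 mB) [_ ^+ 2 / _]mulrC.
congr (fit _ _ <= _)%E; apply/seteqP; split=> y /=;
  by rewrite normrM normfV (ger0_norm (ltW s0)).
Qed.

Context {d} {T : measurableType d} (P : probability T R) (xi : {RV P >-> R}).
Variables (mu s : R).
Hypotheses (s0 : 0 < s)
  (Mxi : same_law (law M) (loss M z) P (fun t => mu + s * xi t)).

Definition standardized_sample i w : R := (loss_sample i w - mu) / s.

Let measurable_std : measurable_fun setT (fun x : R => (x - mu) / s).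
Proof.
apply: measurable_funM; last exact: measurable_cst.
by apply: measurable_funB; [exact: measurable_id|exact: measurable_cst].
Qed.

Lemma measurable_standardized_sample i :
  measurable_fun setT (standardized_sample i).
Proof. exact: (measurableT_comp measurable_std (measurable_loss_sample i)). Qed.

Lemma standardized_sample_independent :
  mutually_independent (Pr M) standardized_sample.
Proof. exact: (mutually_independent_comp measurable_std loss_sample_independent). Qed.

Lemma standardized_sample_law i B : measurable B ->
  Pr M (standardized_sample i @^-1` B) = distribution P xi B.
Proof.
move=> mB; have mB' : measurable ((fun x : R => (x - mu) / s) @^-1` B).
  by rewrite -[_ @^-1` _]setTI; exact: measurable_std.
have := loss_sample_law i mB'.
rewrite Mxi// /distribution /pushforward => E; etransitivity; first exact: E.
congr (P _); apply/seteqP; split=> t /=;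
  by rewrite addrC addKr mulrC mulKf ?gt_eqF.
Qed.

Lemma scenarios_affine N w :
  scenarios z N w = affine_tuple mu s (sample_tuple standardized_sample N w).
Proof.
apply: eq_from_tnth => i; rewrite [LHS]tnth_mktuple [RHS]tnth_map tnth_mktuple /standardized_sample.
by rewrite mulrC divfK ?gt_eqF// addrC subrK.
Qed.

Lemma loss_integral (f : R -> \bar R) : measurable_fun setT f ->
  (\int[law M]_x f (loss M z x) = \int[distribution P xi]_y f (mu + s * y)%R)%E.
Proof.
move=> mf; apply: same_law_integral => //; first exact: measurable_loss.
apply: measurable_funD; first exact: measurable_cst.
by apply: measurable_funM; [exact: measurable_cst|exact: measurable_id].
Qed.

Lemma true_riskE alpha :
  true_risk z alpha = entropic_risk alpha (distribution P xi) (fun y => mu + s * y).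
Proof.
rewrite /true_risk /entropic_risk.
rewrite (loss_integral (f := fun y => (expR (alpha * y))%:E))//.
by apply/measurable_EFinP; exact: measurable_expRM.
Qed.

Lemma loss_variance :
  (\int[distribution P xi]_y y%:E = 0)%E ->
  (\int[distribution P xi]_y (y ^+ 2)%:E = 1)%E ->
  ('V_(law M)[loss M z] = (s ^+ 2)%:E)%E.
Proof.
move=> x1 x2; set L := distribution P xi in x1 x2 *.
have intk k : (k <= 2)%N -> L.-integrable setT (EFin \o (fun y : R => y ^+ k)).
  move=> k2; apply: (integrable_powers (n := 1)) => //.
  by rewrite x2 ltry.
have int1 : L.-integrable setT (EFin \o (idfun : R -> R)) by have := intk 1%N isT.
have EX : ('E_(law M)[loss M z] = mu%:E)%E.
  rewrite unlock (loss_integral (f := EFin)); last by apply/measurable_EFinP.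
  transitivity (\int[L]_y (\sum_(k < 2) [:: mu; s]`_k * y ^+ k)%:E)%E.
    by apply: eq_integral => y _; rewrite !big_ord_recr big_ord0 /= add0r mulr1.
  rewrite (@integral_lincomb _ _ _ L _ (fun k : 'I_2 => [:: mu; s]`_k)
    (fun k y => y ^+ k)); last by move=> k; apply: intk; exact: ltnW (ltn_ord k).
  rewrite !big_ord_recr big_ord0 /= add0r.
  under eq_integral do rewrite expr0.
  rewrite integral_cst//= mul1e probability_setT x1 /=; congr EFin; ring.
rewrite /variance unlock EX /=.
rewrite unlock (loss_integral (f := fun y => ((y - mu) * (y - mu))%:E)); last first.
  apply/measurable_EFinP; apply: measurable_funM;
    by apply: measurable_funB; [exact: measurable_id|exact: measurable_cst].
transitivity (\int[L]_y ((s ^+ 2)%:E * (y ^+ 2)%:E))%E.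
  by apply: eq_integral => y _; rewrite -EFinM; congr EFin; ring.
rewrite integralZl//; last exact: (intk 2%N isT).
by rewrite x2 mule1.
Qed.

End model.

(** * Bounds on the correction term that are uniform over samples *)

Lemma le_1Dsqr {R : realFieldType} (x : R) : x <= 1 + x ^+ 2.
Proof. have := sqr_ge0 (x - 2^-1); lra. Qed.

Section good_samples.
Context {R : realType} (L : probability R R)
  (fit : forall N, N.-tuple R -> probability R R).
Hypothesis measurable_fit : forall N (B : set R), measurable B ->
  measurable_fun setT (fun x : N.-tuple R => fit x B).
Variables (N : nat) (c1 c2 abar : R).

(** Besides heavy tails, the spread of the sample must not be small and the
    fitted law must put enough mass on a fixed half-line for all [N] draws to
    fall there with probability more than one half. *)
Definition good_set (k : nat) : set (N.-tuple R) :=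
  heavy_set fit c1 c2 abar `&` [set x | k.+1%:R^-1 <= tsdev x] `&`
  [set x | ((1 - (4 * N%:R)^-1)%:E <= fit (standardize x) [set u | (u <= k%:R)%R])%E].

Lemma measurable_good_set k : measurable (good_set k).
Proof.
apply: measurableI; first apply: measurableI.
- exact: measurable_heavy_set.
- by apply: measurable_ler_set; [exact: measurable_cst|exact: measurable_tsdev].
- apply: measurable_lee_set; first exact: measurable_cst.
  apply: measurable_fit_standardize => //; apply: measurable_ler_set.
    exact: measurable_id.
  exact: measurable_cst.
Qed.

(** A probability on the line has no mass at infinity, so the sets
    [good_set k] exhaust [heavy_set]. *)
Lemma good_set_gt0 : (0 < N)%N -> iid_law L N (~` heavy_set fit c1 c2 abar) = 0%E ->
  exists k, (0 < iid_law L N (good_set k))%E.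
Proof.
move=> N0 H0; apply: contrapT => /forallNP nk.
have NR : 0 < N%:R :> R by rewrite ltr0n.
have neg k : (iid_law L N).-negligible (good_set k).
  apply/negligibleP; first exact: measurable_good_set.
  by apply/eqP; rewrite -measure_le0 leNgt; apply/negP; exact: nk.
have mheavy := measurable_heavy_set measurable_fit (N := N) c1 c2 abar.
have negH : (iid_law L N).-negligible (~` heavy_set fit c1 c2 abar).
  by apply/negligibleP => //; exact: measurableC.
have : (iid_law L N).-negligible setT.
  apply: negligibleS (negligibleU negH (negligible_bigcup neg)) => x _.
  have [Hx|nHx] := pselect (heavy_set fit c1 c2 abar x); last by left.
  right; have [s0 _] := Hx.
  pose F k := [set u : R | u <= k%:R].
  have mF k : measurable (F k).
    by apply: measurable_ler_set; [exact: measurable_id|exact: measurable_cst].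
  have [k1 Fk1] : exists k, ((1 - (4 * N%:R)^-1)%:E <= fit (standardize x) (F k))%E.
    apply: contrapT => /forallNP nF.
    have Fcvg : fit (standardize x) (F n) @[n --> \oo] -->
        fit (standardize x) (\bigcup_n F n).
      apply: nondecreasing_cvg_mu => //; first exact: bigcup_measurable.
      by move=> i j ij; apply/subsetPset => u /= /le_trans; apply; rewrite ler_nat.
    have FT : \bigcup_n F n = setT.
      apply/seteqP; split=> // u _; exists (Num.truncn `|u|).+1 => //=.
      have /andP[_ /ltW] := truncn_itv (normr_ge0 u).
      exact: le_trans (ler_norm u).
    rewrite FT probability_setT in Fcvg.
    have : (1 <= (1 - (4 * N%:R)^-1)%:E :> \bar R)%E.
      rewrite -(cvg_lim _ Fcvg)//; apply: lime_le; first by apply/cvg_ex; exists 1%E.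
      by apply: nearW => k; apply: ltW; rewrite ltNge; apply/negP; exact: nF.
    by rewrite lee_fin lerBrDl gerDr leNgt invr_gt0 mulr_gt0.
  pose k2 := Num.truncn (tsdev x)^-1; exists (maxn k1 k2) => //; split; first split=> //=.
    rewrite -[leRHS]invrK lef_pV2 ?posrE ?invr_gt0//.
    have /andP[_ /ltW h] := truncn_itv (ltW (etrans (invr_gt0 _) s0)).
    by apply: (le_trans h); rewrite ler_nat ltnS leq_maxr.
  rewrite /=; apply: (le_trans Fk1); apply: le_measure; [exact: mem_set (mF _)|exact: mem_set (mF (maxn k1 k2))|].
  by move=> u /= /le_trans; apply; rewrite ler_nat leq_maxl.
move=> /(negligibleP _ measurableT) P0.
by have := probability_setT (iid_law L N); rewrite [LHS]P0 => /eqP; rewrite eqe eq_sym oner_eq0.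
Qed.

Variables (alpha : R) (delta : forall N, N.-tuple R -> \bar R).
Hypotheses (alpha0 : 0 < alpha) (med : median_bias alpha fit delta) (N1 : (1 < N)%N).

Let N0 : (0 < N)%N. Proof. exact: ltnW. Qed.

Lemma good_set_delta_ge k (x y : N.-tuple R) (mu s : R) :
  0 < c1 -> 0 < c2 -> 0 <= abar -> 0 < s -> x = affine_tuple mu s y ->
  (forall B, measurable B ->
    fit x ((fun u => (u - tmean x) / tsdev x) @^-1` B) = fit (standardize x) B) ->
  good_set k y ->
  let r := alpha * s / k.+1%:R in
  1 <= r -> abar + 1 <= r * c2 ^+ 2 / 2 ->
  2^-1 + k%:R + `|ln c1| <= r * c2 ^+ 2 / 8 ->
  ((r ^+ 2 * c2 ^+ 2 / 8 / alpha)%:E <= delta x)%E.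
Proof.
move=> c10 c20 a0 s0 xE xQ [[[sy tl] sk] Bk] r r1 r2 r3.
have sx : tsdev x = s * tsdev y by rewrite xE tsdev_affine// ltW.
have sx0 : 0 < tsdev x by rewrite sx mulr_gt0.
have stdx : standardize x = standardize y by rewrite xE standardize_affine.
rewrite stdx in xQ.
have rt : r <= alpha * tsdev x.
  by rewrite /r sx mulrA ler_pM2l ?mulr_gt0//.
have c220 : 0 < c2 ^+ 2 by rewrite exprn_gt0.
have r0 : 0 <= r by apply: le_trans r1.
apply: (@le_trans _ _ (((alpha * tsdev x) ^+ 2 * c2 ^+ 2 / 8 / alpha)%:E)).
  rewrite lee_fin ler_pM2r ?invr_gt0// ler_pM2r ?invr_gt0// ler_pM2r//.
  by rewrite lerXn2r ?nnegrE// ?(le_trans r0).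
apply: (heavy_tail_median_ge alpha0 N0 sx0 xQ (proj2 (med N1) x) c10 c20 tl a0
  (ler0n _ k) Bk).
- exact: le_trans rt.
- by apply: (le_trans r2); rewrite ler_pM2r ?invr_gt0// ler_pM2r.
- by apply: (le_trans r3); rewrite ler_pM2r ?invr_gt0// ler_pM2r.
Qed.

Lemma subgaussian_set_moment (c3 : R) : 0 < c3 ->
  exists2 K : R, 0 < K & forall n (x : n.-tuple R), subgaussian_set fit c3 x ->
    (\int[fit (standardize x)]_u (expR (c3 ^- 2 / 4 * u ^+ 2))%:E <= K%:E)%E.
Proof.
move=> c30.
have [K K0 KP] := exp_square_moment (ltr0n R 2) (etrans (invr_gt0 _) (exprn_gt0 2 c30)).
by exists K => // n x [_ tl]; exact: (KP _ _ _ _ (@measurable_id _ _ setT) tl).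
Qed.

(** The correction is quadratic in the spread of the sample, which the sum of
    the squared standardized losses bounds; that sum has expectation [N]. The
    constants depend on [alpha], [N] and [c3] only. *)
Lemma subgaussian_set_delta_le (c3 : R) : 0 < c3 ->
  exists C0 C1 : R, [/\ 0 <= C0, 0 <= C1 & forall (x y : N.-tuple R) (mu s : R),
  1 <= s -> x = affine_tuple mu s y ->
  (forall B, measurable B ->
    fit x ((fun u => (u - tmean x) / tsdev x) @^-1` B) = fit (standardize x) B) ->
  subgaussian_set fit c3 y ->
  ((trisk alpha x)%:E + delta x <=
   (mu + s ^+ 2 * (C0 + C1 * \sum_(i < N) tnth y i ^+ 2))%:E)%E].
Proof.
move=> c30; have [K K0 KP] := subgaussian_set_moment c30.
have L0 : 0 < c3 ^- 2 by rewrite invr_gt0 exprn_gt0.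
have NR : 0 < N%:R :> R by rewrite ltr0n.
have [B hB] : exists B : nat, 2 * expR (- (c3 ^- 2 * B%:R ^+ 2)) <= (4 * N%:R)^-1 :> R.
  pose b := 8 * N%:R / c3 ^- 2 : R.
  exists (Num.truncn b).+1.
  have b0 : 0 <= b by rewrite divr_ge0 ?mulr_ge0// ltW.
  have /andP[_ bB] := truncn_itv b0.
  set B := (Num.truncn b).+1 in bB *.
  have B2 : b <= B%:R ^+ 2.
    apply: (le_trans (ltW bB)); rewrite -natrX ler_nat.
    by rewrite /B expnS expn1 leq_pmulr.
  rewrite expRN -ler_pdivlMl// -invfM lef_pV2 ?posrE ?expR_gt0 ?mulr_gt0//.
  apply: le_trans (expR_ge1Dx _).
  have : 8 * N%:R <= c3 ^- 2 * B%:R ^+ 2 by rewrite [leRHS]mulrC -ler_pdivrMr.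
  lra.
exists (1 + B%:R + `|ln K| / alpha), (1 + B%:R + alpha / c3 ^- 2); split.
- by rewrite !addr_ge0// divr_ge0// ltW//.
- by rewrite !addr_ge0// divr_ge0// ltW//.
move=> x y mu s s1 xE xQ sgy; have s0 : 0 < s by exact: lt_le_trans s1.
have [sy tl] := sgy.
have sx : tsdev x = s * tsdev y by rewrite xE tsdev_affine// ltW.
have sx0 : 0 < tsdev x by rewrite sx mulr_gt0.
have stdx : standardize x = standardize y by rewrite xE standardize_affine.
rewrite stdx in xQ.
have mle : measurable [set u : R | B%:R <= `|u|].
  apply: measurable_ler_set; first exact: measurable_cst.
  exact: (@normr_measurable R setT).
have mge : measurable [set u : R | - B%:R <= u].
  by apply: measurable_ler_set; [exact: measurable_cst|exact: measurable_id].
have hQ : ((1 - (4 * N%:R)^-1)%:E <= fit (standardize y) [set u | (- B%:R <= u)%R])%E.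
  rewrite -[X in fit _ X]setCK probability_setC; last exact: measurableC.
  rewrite EFinB leeB//.
  apply: (@le_trans _ _ (fit (standardize y) [set u | B%:R <= `|u|])).
    apply: le_measure; [apply/mem_set; exact: measurableC|exact/mem_set|].
    move=> u /= /negP; rewrite -ltNge => uB.
    by rewrite -normrN; apply: le_trans (ler_norm _); rewrite lerNr ltW.
  by apply: (le_trans (tl B)); rewrite lee_fin.
have := subgaussian_median_le alpha0 N0 sx0 xQ (proj2 (med N1) x) L0 K0 (KP _ _ sgy) hQ.
set q := \sum_(i < N) _ => dle.
have yq (i : 'I_N) : tnth y i ^+ 2 <= q.
  by rewrite /q (bigD1 i)//= lerDl sumr_ge0// => j _; exact: sqr_ge0.
have q0 : 0 <= q by apply: sumr_ge0 => i _; exact: sqr_ge0.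
have tq : tsdev y ^+ 2 <= q.
  apply: (le_trans (sqr_tsdev_le y N0)); rewrite ler_pdivrMl// -/q.
  by rewrite ler_peMl// ler1n.
have rx : trisk alpha x <= mu + s * (1 + q).
  apply: trisk_le => // i; rewrite xE tnth_map lerD2l ler_pM2l//.
  by apply: (le_trans (le_1Dsqr _)); rewrite lerD2l.
apply: (@le_trans _ _ (mu + s * (1 + q) +
   ((ln K + (alpha * tsdev x) ^+ 2 / c3 ^- 2) / alpha + tsdev x * B%:R))%:E).
  by rewrite EFinD leeD.
rewrite lee_fin sx.
have -> : (ln K + (alpha * (s * tsdev y)) ^+ 2 / c3 ^- 2) / alpha =
    ln K / alpha + s ^+ 2 * (alpha / c3 ^- 2 * tsdev y ^+ 2).
  by field; rewrite !gt_eqF.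
have e1 : ln K / alpha <= s ^+ 2 * (`|ln K| / alpha).
  apply: (@le_trans _ _ (`|ln K| / alpha)).
    by rewrite ler_pM2r ?invr_gt0// ler_norm.
  by rewrite ler_peMl ?divr_ge0 ?(ltW alpha0)// exprn_ege1.
have e2 : alpha / c3 ^- 2 * tsdev y ^+ 2 <= alpha / c3 ^- 2 * q.
  by rewrite ler_pM2l// divr_gt0.
have e3 : s * tsdev y * B%:R <= s ^+ 2 * (1 + q) * B%:R.
  rewrite ler_wpM2r//; apply: (@le_trans _ _ (s * (1 + q))).
    rewrite ler_pM2l//; apply: (le_trans (le_1Dsqr _)).
    by rewrite lerD2l.
  by rewrite ler_wpM2r ?addr_ge0// expr2 ler_peMl// ltW.
have e4 : s * (1 + q) <= s ^+ 2 * (1 + q).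
  by rewrite ler_wpM2r ?addr_ge0// expr2 ler_peMl// ltW.
have e5 : s ^+ 2 * (alpha / c3 ^- 2 * tsdev y ^+ 2) <= s ^+ 2 * (alpha / c3 ^- 2 * q).
  by rewrite ler_pM2l// exprn_gt0.
apply: (@le_trans _ _ (mu + (s ^+ 2 * (1 + q) +
    (s ^+ 2 * (`|ln K| / alpha) + s ^+ 2 * (alpha / c3 ^- 2 * q) +
    s ^+ 2 * (1 + q) * B%:R)))).
  by rewrite -addrA lerD2l lerD// lerD// lerD.
by rewrite le_eqVlt; apply/orP; left; apply/eqP; ring.
Qed.

End good_samples.

(** * Expectations over the samples of a decision problem *)

Section expected_risk.
Context {R : realType} (M : loss_model R) (z : 'rV[R]_(dim_z M)).
Hypothesis dz : decisions z.
Context {d} {T : measurableType d} (P : probability T R) (xi : {RV P >-> R}).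
Variables (mu s : R).
Hypotheses (s0 : 0 < s)
  (Mxi : same_law (law M) (loss M z) P (fun t => mu + s * xi t)).

Let L := distribution P xi.
Hypotheses (L1 : (\int[L]_y y%:E = 0)%E) (L2 : (\int[L]_y (y ^+ 2)%:E = 1)%E).

Let Y := standardized_sample z mu s.
Let Yt N := sample_tuple Y N.

Let mY i : measurable_fun setT (Y i).
Proof. exact: measurable_standardized_sample. Qed.

Let YL i B : measurable B -> Pr M (Y i @^-1` B) = L B.
Proof. exact: standardized_sample_law. Qed.

Let mYt N : measurable_fun setT (Yt N).
Proof. exact: measurable_sample_tuple. Qed.

Lemma standardized_tuple_law N S : measurable S ->
  Pr M (Yt N @^-1` S) = iid_law L N S.
Proof.
move=> mS; apply: sample_tuple_law => //.
exact: standardized_sample_independent.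
Qed.

(** The right-hand side mentions the law of the noise only: this is how almost
    sure properties, and the constants in them, pass from one decision problem
    to another. *)
Lemma ae_standardized_tuple N (S : set (N.-tuple R)) : measurable S ->
  {ae Pr M, forall w, S (Yt N w)} <-> iid_law L N (~` S) = 0%E.
Proof.
move=> mS; have mSC : measurable (~` S) by exact: measurableC.
have mpre : measurable (Yt N @^-1` (~` S)).
  by rewrite -[_ @^-1` _]setTI; exact: mYt.
rewrite -(standardized_tuple_law mSC); split=> [aeS|P0].
  apply/(negligibleP _ mpre); apply: negligibleS aeS; exact: subset_refl.
by move/(negligibleP _ mpre): P0; apply: negligibleS; exact: subset_refl.
Qed.

Let integrableL k : (k <= 2)%N -> L.-integrable setT (EFin \o (fun y : R => y ^+ k)).
Proof.
move=> k2; apply: (integrable_powers (n := 1)) => //.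
by rewrite L2 ltry.
Qed.

Let Y_integral i (f : R -> \bar R) : measurable_fun setT f ->
  (\int[Pr M]_w f (Y i w) = \int[L]_y f y)%E.
Proof.
move=> mf; have YLaw : same_law (Pr M) (Y i) L idfun by move=> B; exact: YL.
exact: (same_law_integral (mY i) (@measurable_id _ _ setT) YLaw mf).
Qed.

Let integrableY i k : (k <= 2)%N ->
  (Pr M).-integrable setT (EFin \o (fun w => Y i w ^+ k)).
Proof.
move=> k2; apply: (integrable_powers (n := 1)) => //.
rewrite (Y_integral i (f := fun y => (y ^+ 2)%:E)).
  by rewrite L2 ltry.
by apply/measurable_EFinP; apply: measurable_funX; exact: measurable_id.
Qed.

Lemma measurable_corrected_risk alpha
    (fit : forall N, N.-tuple R -> probability R R)
    (delta : forall N, N.-tuple R -> \bar R) N : (1 < N)%N ->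
  median_bias alpha fit delta ->
  measurable_fun setT (fun w => corrected_risk z alpha delta N w).
Proof.
move=> N1 med.
rewrite (_ : (fun w => _) = (fun x : N.-tuple R => (trisk alpha x)%:E + delta N x)%E
    \o (scenarios z N)); last first.
  by apply/funext => w; rewrite corrected_riskE// ltnW.
apply: measurableT_comp; last exact: (measurable_sample_tuple (measurable_loss_sample dz)).
apply: emeasurable_funD; last exact: (proj1 (med N N1)).
by apply/measurable_EFinP; exact: measurable_trisk.
Qed.

Lemma standardized_tmean N : (0 < N)%N ->
  (Pr M).-integrable setT (EFin \o (fun w => tmean (Yt N w))) /\
  (\int[Pr M]_w (tmean (Yt N w))%:E = 0)%E.
Proof.
move=> N0.
have tmeanE w : tmean (Yt N w) = \sum_(i < N) N%:R^-1 * Y i w.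
  by rewrite /tmean mulr_sumr; apply: eq_bigr => i _; rewrite tnth_mktuple.
have intY i : (Pr M).-integrable setT (EFin \o Y i) by have := integrableY i (leqnSn 1).
split.
  rewrite (_ : _ \o _ = (fun w => \sum_(i < N) (N%:R^-1)%:E * (Y i w)%:E)%E).
    by apply: integrable_sum => // i _; exact: (integrableZl measurableT _ (intY i)).
  by apply/funext => w /=; rewrite tmeanE -sumEFin.
under eq_integral do rewrite tmeanE.
rewrite (@integral_lincomb _ _ _ (Pr M) _ (fun=> N%:R^-1) (fun i : 'I_N => Y i));
  last by move=> i; exact: intY.
rewrite big1// => i _; rewrite (Y_integral i (f := EFin)) ?L1 ?mulr0//.
Qed.

Variables (alpha : R) (delta : forall N, N.-tuple R -> \bar R) (N : nat).
Hypotheses (alpha0 : 0 < alpha) (N1 : (1 < N)%N)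
  (mcr : measurable_fun setT (fun w => corrected_risk z alpha delta N w)).

Let N0 : (0 < N)%N. Proof. exact: ltnW. Qed.

Lemma expected_corrected_risk_ge (S : set (N.-tuple R)) (c0 c : R) :
  measurable S ->
  (forall w, ((mu + s * tmean (Yt N w) - c0 + c * \1_S (Yt N w))%:E <=
    corrected_risk z alpha delta N w)%E) ->
  ((mu - c0 + c * fine (iid_law L N S))%:E <=
   expected_corrected_risk z alpha delta N)%E.
Proof.
move=> mS lb; have [int1 int0] := standardized_tmean N0.
pose f (k : 'I_3) := nth (cst 1 : Omega M -> R)
  [:: cst 1; (fun w => tmean (Yt N w)); (fun w => \1_S (Yt N w))] k.
pose a (k : 'I_3) := [:: mu - c0; s; c]`_k.
have mpre : measurable (Yt N @^-1` S) by rewrite -[_ @^-1` _]setTI; exact: mYt.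
have indE : (fun w => \1_S (Yt N w)) = \1_(Yt N @^-1` S) :> (Omega M -> R).
  by apply/funext => w; rewrite !indicE; congr (_%:R); apply/idP/idP => /set_mem h; exact/mem_set.
have intf k : (Pr M).-integrable setT (EFin \o f k).
  case: k => [[|[|[|k]]] kP] //.
  - exact: finite_measure_integrable_cst.
  - rewrite (_ : f _ = \1_(Yt N @^-1` S)); last by rewrite -indE.
    by apply: integrable_indic => //; exact: fin_num_measure.
have fE w : \sum_k a k * f k w =
    mu + s * tmean (Yt N w) - c0 + c * \1_S (Yt N w).
  by rewrite !big_ord_recr big_ord0 /= /a /f /=; ring.
have -> : (mu - c0 + c * fine (iid_law L N S))%:E =
    (\int[Pr M]_w (\sum_k a k * f k w)%:E)%E.
  rewrite integral_lincomb// !big_ord_recr big_ord0 /= /a /f /= add0r.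
  rewrite integral_cst//= mul1e probability_setT int0 /= mulr1 mulr0 addr0.
  congr (_ + c * fine _)%:E.
  rewrite -(standardized_tuple_law mS) -[in LHS](setIT (Yt N @^-1` S)).
  by rewrite -integral_indic//; apply: eq_integral => w _.
apply: ae_le_integral_measurable => //.
  apply/measurable_EFinP; apply: measurable_sum => k.
  apply: measurable_funM; first exact: measurable_cst.
  by apply/measurable_EFinP; exact: (measurable_int _ (intf k)).
by apply: aeW => w; rewrite fE.
Qed.

Lemma expected_corrected_risk_le (c0 c : R) : 0 <= c ->
  {ae Pr M, forall w, (corrected_risk z alpha delta N w <=
    (c0 + c * \sum_(i < N) tnth (Yt N w) i ^+ 2)%:E)%E} ->
  (expected_corrected_risk z alpha delta N <= (c0 + c * N%:R)%:E)%E.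
Proof.
move=> c_ge0 ub.
pose f (k : 'I_N.+1) (w : Omega M) : R := if unlift ord0 k is Some i then Y i w ^+ 2 else 1.
pose a (k : 'I_N.+1) : R := if unlift ord0 k is Some i then c else c0.
have intf k : (Pr M).-integrable setT (EFin \o f k).
  rewrite /f; case: unlift => [i|]; first exact: integrableY.
  exact: finite_measure_integrable_cst.
have fE w : \sum_k a k * f k w = c0 + c * \sum_(i < N) tnth (Yt N w) i ^+ 2.
  rewrite big_ord_recl /a /f unlift_none mulr1 mulr_sumr; congr (_ + _).
  by apply: eq_bigr => i _; rewrite liftK tnth_mktuple.
have -> : (c0 + c * N%:R)%:E = (\int[Pr M]_w (\sum_k a k * f k w)%:E)%E.
  rewrite integral_lincomb// big_ord_recl /a /f unlift_none.
  rewrite integral_cst//= mul1e probability_setT mulr1; congr (_ + _)%:E.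
  rewrite (eq_bigr (fun=> c)) => [|i _].
    by rewrite sumr_const card_ord mulr_natr.
  rewrite liftK (Y_integral i (f := fun y => (y ^+ 2)%:E)) ?L2 ?mulr1//.
  by apply/measurable_EFinP; apply: measurable_funX; exact: measurable_id.
apply: ae_le_integral_measurable => //.
  apply/measurable_EFinP; apply: measurable_sum => k.
  apply: measurable_funM; first exact: measurable_cst.
  by apply/measurable_EFinP; exact: (measurable_int _ (intf k)).
by apply: filterS ub => w; rewrite fE.
Qed.

Let risk_moment : (\int[L]_y (expR (alpha * (mu + s * y)))%:E =
  (expR (alpha * mu))%:E * \int[L]_y (expR (alpha * s * y))%:E)%E.
Proof.
have mexp : measurable_fun setT (fun u : R => (expR (alpha * s * u))%:E).
  by apply/measurable_EFinP; exact: measurable_expRM.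
rewrite -ge0_integralZl//.
by apply: eq_integral => u _; rewrite -EFinM -expRD mulrDr mulrA.
Qed.

Lemma true_risk_ge : (mu%:E <= true_risk z alpha)%E.
Proof.
rewrite (true_riskE dz Mxi); apply: entropic_risk_ge => //.
rewrite risk_moment -[leLHS]mule1 lee_pmul2l ?lte_fin ?expR_gt0//.
have := expR_jensen (alpha * s) (integrableL (leqnSn 1) : L.-integrable setT (EFin \o (idfun : R -> R))) L1.
by rewrite mulr0 expR0.
Qed.

Lemma true_risk_le (l K : R) : 0 < l -> 0 < K ->
  (\int[L]_y (expR (l / 4 * y ^+ 2))%:E <= K%:E)%E ->
  (true_risk z alpha <= (mu + ln K / alpha + alpha * s ^+ 2 / l)%:E)%E.
Proof.
move=> l0 K0 LK; rewrite (true_riskE dz Mxi); apply: entropic_risk_le => //.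
rewrite risk_moment.
have -> : alpha * (mu + ln K / alpha + alpha * s ^+ 2 / l) =
  alpha * mu + (ln K + (alpha * s) ^+ 2 / l) by field; rewrite !gt_eqF.
rewrite expRD EFinM lee_pmul2l ?lte_fin ?expR_gt0// expRD lnK//.
exact: (exp_linear_moment (alpha * s) l0 (@measurable_id _ _ setT) LK).
Qed.

(** The squared noise is at most a multiple of the squared loss plus a
    constant. *)
Lemma noise_exp_square (k : R) : 0 < k ->
  lighter_than_gaussian (law M) (loss M z) ->
  exists2 K : R, 0 < K & (\int[L]_y (expR (k * y ^+ 2))%:E <= K%:E)%E.
Proof.
move=> k0 lM; pose k' := 2 * k / s ^+ 2.
have k'0 : 0 < k' by rewrite divr_gt0 ?mulr_gt0 ?exprn_gt0.
have [K KP] := lighter_than_gaussian_exp_square k'0 lM (measurable_loss dz).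
pose g (y : R) := (expR (k * y ^+ 2))%:E.
have mg : measurable_fun setT g.
  suff mg' : measurable_fun setT (fun y : R => expR (k * y ^+ 2)).
    exact/measurable_EFinP.
  apply: (measurableT_comp (@measurable_expR R) (g := fun t : R => k * t ^+ 2)).
  by apply: measurable_funM; [exact: measurable_cst|exact: measurable_funX].
have mstd : measurable_fun setT (fun x : R => (x - mu) / s).
  apply: measurable_funM; last exact: measurable_cst.
  by apply: measurable_funB; [exact: measurable_id|exact: measurable_cst].
have mk' : measurable_fun setT (fun x => (expR (k' * loss M z x ^+ 2))%:E).
  suff mg' : measurable_fun setT (fun x => expR (k' * loss M z x ^+ 2)).
    exact/measurable_EFinP.
  apply: (measurableT_comp (@measurable_expR R)
    (g := fun t => k' * loss M z t ^+ 2)).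
  apply: measurable_funM; first exact: measurable_cst.
  by apply: measurable_funX; exact: measurable_loss.
exists (Num.max 1 (expR (k' * mu ^+ 2) * K)); first by rewrite lt_max ltr01.
have <- : (\int[law M]_x g ((loss M z x - mu) / s)%R = \int[L]_y g y)%E.
  rewrite (loss_integral dz Mxi (f := fun x => g ((x - mu) / s))); last first.
    exact: (measurableT_comp mg mstd).
  by apply: eq_integral => y _; rewrite addrC addKr mulrC mulKf ?gt_eqF.
apply: (@le_trans _ _ (expR (k' * mu ^+ 2) * K)%:E); last first.
  by rewrite lee_fin le_max lexx orbT.
apply: (@le_trans _ _ (\int[law M]_x ((expR (k' * mu ^+ 2))%:E *
    (expR (k' * loss M z x ^+ 2))%:E))%E).
  apply: ae_le_integral_measurable.
  - exact: (measurableT_comp mg (measurableT_comp mstd (measurable_loss dz))).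
  - exact: measurable_funeM.
  apply: aeW => x; rewrite /g -EFinM lee_fin -expRD ler_expR -mulrDr.
  have -> : k * ((loss M z x - mu) / s) ^+ 2 = k' * ((loss M z x - mu) ^+ 2 / 2).
    by rewrite /k'; field; rewrite gt_eqF.
  rewrite ler_pM2l//.
  have := sqr_ge0 (loss M z x + mu); lra.
by rewrite ge0_integralZl// EFinM; apply: lee_wpmul2l => //.
Qed.

End expected_risk.

(** * Strong consistency *)

Section consistency.
Context {R : realType} (M : loss_model R) (z : 'rV[R]_(dim_z M)).
Hypotheses (dz : decisions z)
  (lighter : lighter_than_gaussian (law M) (loss M z)).

Lemma loss_strong_law (f : R -> R) : measurable_fun setT f ->
  (\int[law M]_x (f (loss M z x) ^+ 4)%:E < +oo)%E ->
  {ae Pr M, forall w,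
    (N%:R^-1 * \sum_(i < N) f (loss_sample z i w)) @[N --> \oo] -->
    fine (\int[law M]_x (f (loss M z x))%:E)%E}.
Proof.
move=> mf f4.
have mfl : measurable_fun setT (f \o loss M z).
  by apply: measurableT_comp => //; exact: measurable_loss.
pose F : {mfun _ >-> R} := HB.pack (f \o loss M z) (isMeasurableFun.Build _ _ _ _ _ mfl).
have mid : measurable_fun setT (idfun : R -> R) by exact: measurable_id.
have law_F : same_law (distribution (law M) F) idfun (law M) (f \o loss M z) by [].
have lawE (g : R -> \bar R) : measurable_fun setT g ->
    (\int[distribution (law M) F]_y g y = \int[law M]_x g (f (loss M z x)))%E.
  by move=> mg; exact: (same_law_integral mid mfl law_F mg).
rewrite -(lawE EFin); last by apply/measurable_EFinP.
apply: (strong_law (X := fun i => f \o loss_sample z i)).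
- by move=> i; apply: measurableT_comp => //; exact: measurable_loss_sample.
- exact: (mutually_independent_comp mf (loss_sample_independent dz)).
- move=> i B mB; apply: (loss_sample_law dz i (B := f @^-1` B)).
  by rewrite -[_ @^-1` _]setTI; exact: mf.
- rewrite (lawE (fun y => (y ^+ 4)%:E))//.
  by apply/measurable_EFinP; exact: measurable_funX.
Qed.

Lemma loss_exp_moment (a : R) : exists K : R,
  (\int[law M]_x (expR (a * loss M z x))%:E <= K%:E)%E.
Proof.
have [K KP] := lighter_than_gaussian_exp_square ltr01 lighter (measurable_loss dz).
exists (K * expR (a ^+ 2 / 4)).
apply: (exp_linear_moment _ (ltr0n R 4) (measurable_loss dz)).
by under eq_integral do rewrite divff//.
Qed.

Lemma loss_moment8 : (\int[law M]_x ((loss M z x ^+ 2) ^+ 4)%:E < +oo)%E.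
Proof.
have [K KP] := lighter_than_gaussian_exp_square ltr01 lighter (measurable_loss dz).
have mexp : measurable_fun setT (fun x => (expR (1 * loss M z x ^+ 2))%:E).
  suff mg' : measurable_fun setT (fun x => expR (1 * loss M z x ^+ 2)).
    exact/measurable_EFinP.
  apply: (measurableT_comp (@measurable_expR R) (g := fun x => 1 * loss M z x ^+ 2)).
  apply: measurable_funM; first exact: measurable_cst.
  by apply: measurable_funX; exact: measurable_loss.
apply: (@le_lt_trans _ _ (4 ^+ 4 * K)%:E); last exact: ltry.
apply: (@le_trans _ _ (\int[law M]_x ((4 ^+ 4)%:E * (expR (1 * loss M z x ^+ 2))%:E))%E).
  apply: ae_le_integral_measurable.
  - apply/measurable_EFinP; apply: measurable_funX; apply: measurable_funX.
    exact: measurable_loss.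
  - exact: measurable_funeM.
  apply: aeW => x; rewrite -EFinM lee_fin mul1r.
  set v := loss M z x ^+ 2; have v0 : 0 <= v by exact: sqr_ge0.
  (* v / 4 <= exp (v / 4), raised to the fourth power *)
  have -> : expR v = expR (v / 4) ^+ 4 by rewrite -expRM_natl mulrC divfK.
  have -> : v ^+ 4 = 4 ^+ 4 * (v / 4) ^+ 4 by rewrite -exprMn mulrC divfK.
  rewrite ler_pM2l ?exprn_gt0//.
  apply: lerXn2r; rewrite ?nnegrE ?expR_ge0 ?divr_ge0//.
  by apply: le_trans (expR_ge1Dx _); rewrite lerDr.
rewrite ge0_integralZl// ?lee_fin ?exprn_ge0//.
by rewrite [leRHS]EFinM; apply: lee_wpmul2l; rewrite ?lee_fin ?exprn_ge0.
Qed.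

Variables (alpha : R) (fit : forall N, N.-tuple R -> probability R R)
  (delta : forall N, N.-tuple R -> \bar R).
Hypotheses (alpha0 : 0 < alpha) (med : median_bias alpha fit delta).

Lemma ae_trisk_cvg : {ae Pr M, forall w, exists2 r : R,
  trisk alpha (scenarios z N w) @[N --> \oo] --> r & true_risk z alpha = r%:E}.
Proof.
pose I := (\int[law M]_x (expR (alpha * loss M z x))%:E)%E.
have mexp : measurable_fun setT (fun x => expR (alpha * loss M z x)).
  by apply: (measurableT_comp (measurable_expRM alpha)); exact: measurable_loss.
have I0 : (0 < I)%E.
  by apply: probability_integral_gt0 => // x; exact: expR_gt0.
have IE : I = (fine I)%:E.
  have [K KP] := loss_exp_moment alpha.
  by rewrite fineK// ge0_fin_numE ?(ltW I0)// (le_lt_trans KP)// ltry.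
have e0 : 0 < fine I by rewrite -lte_fin -IE.
have e4 : (\int[law M]_x (expR (alpha * loss M z x) ^+ 4)%:E < +oo)%E.
  have [K KP] := loss_exp_moment (4 * alpha).
  apply: le_lt_trans (ltry K).
  by under eq_integral do rewrite -expRM_natl mulrA.
apply: filterS (loss_strong_law (measurable_expRM alpha) e4) => w cvgI.
exists (alpha^-1 * ln (fine I)); last exact: entropic_risk_EFin.
rewrite (_ : (fun N => _) = (fun N => alpha^-1 *
    ln (N%:R^-1 * \sum_(i < N) expR (alpha * loss_sample z i w)))); last first.
  apply/funext => N; rewrite /trisk; congr (_ * ln (_ * _)).
  by apply: eq_bigr => i _; rewrite tnth_mktuple.
apply: cvgMr; apply: continuous_cvg cvgI; exact: continuous_ln.
Qed.

(** The spread of the sample converges, hence is bounded along almost every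
    sample path; with it, so are the moments in the bound on the median. *)
Lemma ae_delta_cvg0 (c3 : R) : 0 < c3 -> affine_equivariance z fit ->
  mean_matching z fit ->
  (forall N, (1 < N)%N ->
    {ae Pr M, forall w, subgaussian_set fit c3 (scenarios z N w)}) ->
  {ae Pr M, forall w, delta (scenarios z N w) @[N --> \oo] --> 0%E}.
Proof.
move=> c30 equi mm sub; have [K K0 KP] := subgaussian_set_moment fit c30.
have L0 : 0 < c3 ^- 2 by rewrite invr_gt0 exprn_gt0.
have ae_all : {ae Pr M, forall w, forall N, (1 < N)%N ->
    subgaussian_set fit c3 (scenarios z N w) /\
    (\int[fit (scenarios z N w)]_y y%:E = (muhat z N w)%:E)%E}.
  apply: ae_foralln => N; case: (ltnP 1 N) => [N1|_]; last exact: aeW.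
  by apply: filterS2 (sub N N1) (mm N N1) => w h1 h2 _.
have msq : measurable_fun setT (fun y : R => y ^+ 2).
  by apply: measurable_funX; exact: measurable_id.
apply: filterS2 ae_all (loss_strong_law msq loss_moment8) => w hw.
set v := fine _ => cvgv.
pose V := v + 1; pose Z := K * expR (16 * (alpha ^+ 2 * V) / c3 ^- 2) + 1.
have small (e : R) : 0 < e <= 2^-1 -> \forall N \near \oo,
    (`|delta (scenarios z N w)| <= (2 * e / alpha)%:E)%E.
  move=> /andP[e0 e2]; have e40 : 0 < e ^+ 4 by rewrite exprn_gt0.
  move/cvgrPdist_lt : cvgv => /(_ _ ltr01) nv.
  near=> N.
  have N1 : (1 < N)%N by near: N; exact: nbhs_infty_gt.
  have N0 : (0 < N)%N by exact: ltnW.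
  have [sg mmN] := hw N N1; have [s0 _] := sg.
  rewrite muhatE// in mmN.
  have xQ := fun B mB => @fit_standardize _ _ _ fit N w B equi N1 mB.
  apply: (subgaussian_median_small alpha0 N0 s0 xQ (proj2 (med N1) _) L0 K0
    (KP _ _ sg) mmN); first by rewrite e0.
  have sV : tsdev (scenarios z N w) ^+ 2 <= V.
    apply: (le_trans (sqr_tsdev_le _ N0)).
    rewrite (eq_bigr (fun i : 'I_N => loss_sample z i w ^+ 2)); last first.
      by move=> i _; rewrite tnth_mktuple.
    have : `|v - N%:R^-1 * \sum_(i < N) loss_sample z i w ^+ 2| < 1 by near: N.
    rewrite ltr_norml => /andP[/ltW + _].
    by rewrite lerBrDr addrC lerBlDr.
  apply: (@le_lt_trans _ _ (48 * Z)).
    rewrite ler_pM2l// lerD2r ler_pM2l// ler_expR ler_pM2r ?invr_gt0 ?exprn_gt0//.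
    rewrite ler_pM2l// exprMn ler_pM2l// exprn_gt0//.
  rewrite -ltr_pdivrMr//.
  have : 48 * Z / e ^+ 4 < N%:R.
    by near: N; exact: nbhs_infty_gtr.
  move/lt_le_trans; apply.
  by rewrite -natrX ler_nat expnS expn1 leq_pmulr.
have dfin : \forall N \near \oo, delta (scenarios z N w) \is a fin_num.
  have h : (0 : R) < (2 : R)^-1 <= (2 : R)^-1 by rewrite lexx andbT invr_gt0.
  apply: filterS (small _ h) => N; rewrite fin_num_abs => /le_lt_trans; apply.
  exact: ltry.
apply/fine_cvgP; split=> //.
apply/cvgrPdist_le => e e0.
pose e' := Num.min 2^-1 (e * alpha / 2).
have e'P : 0 < e' <= 2^-1.
  by rewrite /e' lt_min invr_gt0 ltr0n/= ge_min lexx andbT divr_gt0// mulr_gt0.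
have e'e : 2 * e' / alpha <= e.
  rewrite ler_pdivrMr// -ler_pdivlMl// mulrC ge_min; apply/orP; right.
  by [].
apply: filterS2 dfin (small _ e'P) => N df.
rewrite sub0r normrN => h; apply: le_trans e'e.
by move: df h => /=; case: (delta _).
Unshelve. all: by end_near. Qed.

Lemma ae_corrected_risk_cvg (c3 : R) : 0 < c3 -> affine_equivariance z fit ->
  mean_matching z fit ->
  (forall N, (1 < N)%N ->
    {ae Pr M, forall w, subgaussian_set fit c3 (scenarios z N w)}) ->
  {ae Pr M, forall w,
    corrected_risk z alpha delta N w @[N --> \oo] --> true_risk z alpha}.
Proof.
move=> c30 equi mm sub.
apply: filterS2 ae_trisk_cvg (ae_delta_cvg0 c30 equi mm sub) => w [r rcvg ->] dcvg.
have sum_cvg : ((trisk alpha (scenarios z N w))%:E + delta (scenarios z N w))%E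
    @[N --> \oo] --> (r%:E + 0)%E.
  apply: cvgeD => //.
  by apply: cvg_EFin => //; exact: nearW.
rewrite adde0 in sum_cvg; apply: cvg_trans sum_cvg; apply: near_eq_cvg; near=> N.
have N0 : (0 < N)%N by near: N; exact: nbhs_infty_gt.
by rewrite corrected_riskE.
Unshelve. all: by end_near. Qed.

End consistency.

(** * Uniform estimates over all decision problems *)

Lemma risk_arith {R : realFieldType} (v x u c0 mu : R) : x <= u ->
  c0 + u <= v / 4 -> v / 2 + (mu + x + v / 4) <= mu - c0 + v.
Proof. lra. Qed.

Section uniform.
Context {R : realType} (alpha : R) {d} {T : measurableType d}
  (P : probability T R) (xi : {RV P >-> R})
  (fit : forall N, N.-tuple R -> probability R R)
  (delta : forall N, N.-tuple R -> \bar R).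

Let L := distribution P xi.
Hypotheses (alpha0 : 0 < alpha)
  (L1 : (\int[L]_y y%:E = 0)%E) (L2 : (\int[L]_y (y ^+ 2)%:E = 1)%E)
  (measurable_fit : forall N (B : set R), measurable B ->
     measurable_fun setT (fun x : N.-tuple R => fit x B))
  (med : median_bias alpha fit delta).
Variable N : nat.
Hypothesis N1 : (1 < N)%N.

Let N0 : (0 < N)%N. Proof. exact: ltnW. Qed.

(** On the good samples, which have positive probability, the correction is of
    order [s^2]; elsewhere it is bounded below by a constant. The true risk
    exceeds the mean by an arbitrarily small multiple of [s^2] only. *)
Lemma expected_overestimation (c1 c2 abar : R) :
  0 < c1 -> 0 < c2 -> 0 < abar ->
  iid_law L N (~` heavy_set fit c1 c2 abar) = 0%E ->
  (forall k : R, 0 < k ->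
    exists2 K : R, 0 < K & (\int[L]_y (expR (k * y ^+ 2))%:E <= K%:E)%E) ->
  exists c sbar : R, [/\ 0 < c, 0 < sbar &
    forall (M : loss_model R) (z : 'rV[R]_(dim_z M)) (mu s : R),
      decisions z -> same_law (law M) (loss M z) P (fun t => mu + s * xi t) ->
      affine_equivariance z fit -> sbar <= s ->
      ((c * s ^+ 2)%:E <=
       expected_corrected_risk z alpha delta N - true_risk z alpha)%E].
Proof.
move=> c10 c20 a0 H0 Lexp.
have [k pk] := good_set_gt0 measurable_fit N0 H0.
have mgood := measurable_good_set measurable_fit (N := N) c1 c2 abar k.
set S := good_set _ _ _ _ k in pk mgood.
pose p := fine (iid_law L N S).
have p0 : 0 < p.
  by rewrite fine_gt0// pk /= (le_lt_trans (probability_le1 _ mgood))// ltry.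
pose b := alpha / k.+1%:R; have b0 : 0 < b by rewrite divr_gt0.
have c220 : 0 < c2 ^+ 2 by rewrite exprn_gt0.
pose a := b ^+ 2 * c2 ^+ 2 / 8 / alpha.
have a_gt0 : 0 < a by rewrite !divr_gt0// mulr_gt0// exprn_gt0.
have ap : 0 < a * p by rewrite mulr_gt0.
pose l := alpha / (a * p / 4).
have l0 : 0 < l by rewrite divr_gt0// divr_gt0.
have [K K0 LK] := Lexp _ (divr_gt0 l0 (ltr0n R 4)).
pose c0 := alpha^-1 * ln 3.
pose t1 := b^-1; pose t2 := (abar + 1) * 2 / c2 ^+ 2 / b.
pose t3 := (2^-1 + k%:R + `|ln c1|) * 8 / c2 ^+ 2 / b.
pose t4 := 4 * (c0 + `|ln K / alpha|) / (a * p).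
have c00 : 0 <= c0 by rewrite mulr_ge0 ?invr_ge0 ?ln_ge0 ?ler1n// ltW.
have t1p : 0 <= t1 by rewrite invr_ge0 ltW.
have t2p : 0 <= t2.
  by rewrite !divr_ge0 ?mulr_ge0 ?addr_ge0// ltW.
have t3p : 0 <= t3.
  by rewrite !divr_ge0 ?mulr_ge0 ?addr_ge0// ltW.
have t4p : 0 <= t4 by rewrite divr_ge0 ?(ltW ap)// mulr_ge0// addr_ge0.
exists (a * p / 2), (1 + t1 + t2 + t3 + t4); split.
- by rewrite divr_gt0.
- by rewrite -!addrA ltr_pwDl// !addr_ge0.
move=> M z mu s dz Mxi equi sbar.
have [s1 [st1 [st2 [st3 st4]]]] : 1 <= s /\ t1 <= s /\ t2 <= s /\ t3 <= s /\ t4 <= s.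
  have le5 (x : R) : x <= 1 + t1 + t2 + t3 + t4 -> x <= s by move=> /le_trans; apply.
  split; first by apply: le5; rewrite -!addrA lerDl !addr_ge0.
  split; first by apply: le5; rewrite [1 + _]addrC -!addrA lerDl !addr_ge0.
  split; first by apply: le5; rewrite [_ + t2]addrC -!addrA lerDl !addr_ge0.
  split; first by apply: le5; rewrite [_ + t3]addrC -!addrA lerDl !addr_ge0.
  by apply: le5; rewrite lerDr !addr_ge0.
have s0 : 0 < s by exact: lt_le_trans s1.
pose y w := sample_tuple (standardized_sample z mu s) N w.
have scE w : scenarios z N w = affine_tuple mu s (y w) by exact: scenarios_affine.
have rE : alpha * s / k.+1%:R = b * s by rewrite /b mulrAC.
have low w : ((mu + s * tmean (y w) - c0 + a * s ^+ 2 * \1_S (y w))%:E <=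
    corrected_risk z alpha delta N w)%E.
  rewrite corrected_riskE//.
  have m1 : mu + s * tmean (y w) <= trisk alpha (scenarios z N w).
    by rewrite -tmean_affine// -scE; exact: tmean_le_trisk.
  have d1 := risk_gap_median_ge alpha0 N0 (proj2 (med N1) (scenarios z N w)).
  rewrite indicE; have [/set_mem Sy|_] := boolP (_ \in S); last first.
    by rewrite mulr0 addr0 EFinB leeD// -EFinN.
  have xQ := fun B mB => @fit_standardize _ _ _ fit N w B equi N1 mB.
  have d2 : ((a * s ^+ 2)%:E <= delta (scenarios z N w))%E.
    have -> : a * s ^+ 2 = (alpha * s / k.+1%:R) ^+ 2 * c2 ^+ 2 / 8 / alpha.
      by rewrite rE /a; ring.
    apply: (good_set_delta_ge alpha0 med N1 c10 c20 (ltW a0) s0 (scE w) xQ Sy);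
      rewrite rE.
    - by rewrite mulrC -ler_pdivrMr// mul1r.
    - by move: st2; rewrite /t2 !ler_pdivrMr// ler_pdivlMr// [b * s]mulrC.
    - by move: st3; rewrite /t3 !ler_pdivrMr// ler_pdivlMr// [b * s]mulrC.
  rewrite mulr1; apply: (@le_trans _ _ ((mu + s * tmean (y w))%:E + (a * s ^+ 2)%:E)%E).
    by rewrite -EFinD lee_fin lerD2r gerBl.
  by rewrite leeD.
have mcr := measurable_corrected_risk dz N1 med.
have Ege := expected_corrected_risk_ge dz s0 Mxi L1 L2 N1 mcr mgood low.
have rle := true_risk_le dz Mxi alpha0 l0 K0 LK.
have rge := true_risk_ge dz Mxi L1 L2 alpha0.
have rfin : true_risk z alpha \is a fin_num.
  by rewrite fin_numE -ltNye -ltey (lt_le_trans (ltNyr _) rge) (le_lt_trans rle (ltry _)).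
rewrite leeBrDr//; apply: le_trans Ege.
apply: (@le_trans _ _ ((a * p / 2 * s ^+ 2)%:E + (mu + ln K / alpha + alpha * s ^+ 2 / l)%:E)%E).
  by rewrite leeD2l.
rewrite -EFinD lee_fin -/p.
have -> : alpha * s ^+ 2 / l = a * p / 4 * s ^+ 2.
  by rewrite /l; field; rewrite !gt_eqF.
have s2 : s <= s ^+ 2 by rewrite expr2 ler_peMl// ltW.
have : c0 + `|ln K / alpha| <= a * p / 4 * s ^+ 2.
  have := le_trans st4 s2; rewrite /t4 ler_pdivrMr//; move: (c0 + _) => u.
  by move=> h; rewrite -(@ler_pM2l _ 4)//; apply: (le_trans h); rewrite le_eqVlt; apply/orP; left; apply/eqP; field.
have := ler_norm (ln K / alpha).
have -> : a * s ^+ 2 * p = a * p * s ^+ 2 by ring.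
have -> : a * p / 2 * s ^+ 2 = a * p * s ^+ 2 / 2 by ring.
have -> : a * p / 4 * s ^+ 2 = a * p * s ^+ 2 / 4 by ring.
exact: risk_arith.
Qed.

(** The true risk is at least the mean, so only the expectation of the corrected
    risk needs an upper bound. *)
Lemma expected_upper_bound (c3 : R) : 0 < c3 ->
  iid_law L N (~` subgaussian_set fit c3) = 0%E ->
  exists2 c : R, 0 < c &
    forall (M : loss_model R) (z : 'rV[R]_(dim_z M)) (mu s : R),
      decisions z -> same_law (law M) (loss M z) P (fun t => mu + s * xi t) ->
      affine_equivariance z fit -> 1 <= s ->
      (expected_corrected_risk z alpha delta N - true_risk z alpha <=
       (c * s ^+ 2)%:E)%E.
Proof.
move=> c30 H0.
have [C0 [C1 [C00 C10 ub]]] := subgaussian_set_delta_le alpha0 med N1 c30.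
exists (1 + C0 + C1 * N%:R).
  by rewrite -addrA ltr_pwDl// addr_ge0// mulr_ge0.
move=> M z mu s dz Mxi equi s1; have s0 : 0 < s by exact: lt_le_trans s1.
have mcr := measurable_corrected_risk dz N1 med.
have rge := true_risk_ge dz Mxi L1 L2 alpha0.
have msub := measurable_subgaussian_set measurable_fit (N := N) c3.
have aesub := (proj2 (ae_standardized_tuple dz s0 Mxi msub)) H0.
have Ele : (expected_corrected_risk z alpha delta N <=
    (mu + s ^+ 2 * C0 + s ^+ 2 * C1 * N%:R)%:E)%E.
  apply: (expected_corrected_risk_le dz s0 Mxi L2 mcr).
    by rewrite mulr_ge0 ?sqr_ge0.
  apply: filterS aesub => w Sw; rewrite corrected_riskE//.
  have xQ := fun B mB => @fit_standardize _ _ _ fit N w B equi N1 mB.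
  apply: (le_trans (ub _ _ mu s s1 (scenarios_affine z mu s0 N w) xQ Sw)).
  rewrite lee_fin le_eqVlt; apply/orP; left; apply/eqP; ring.
apply: (@le_trans _ _ ((mu + s ^+ 2 * C0 + s ^+ 2 * C1 * N%:R)%:E - mu%:E)%E).
  by rewrite leeB.
rewrite -EFinB lee_fin.
have -> : (1 + C0 + C1 * N%:R) * s ^+ 2 =
  s ^+ 2 + (s ^+ 2 * C0 + s ^+ 2 * C1 * N%:R) by ring.
by rewrite -[mu + _ + _]addrA addrAC subrr add0r lerDr sqr_ge0.
Qed.

End uniform.

Lemma abse_subC {R : realDomainType} (x y : \bar R) : x \is a fin_num ->
  (`|x - y| = `|y - x|)%E.
Proof. by move=> xf; rewrite -[RHS]abseN fin_num_oppeB// addeC. Qed.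

Lemma location_scale_decision {R : realType} (M : loss_model R)
    (z : 'rV[R]_(dim_z M)) {d} {T : measurableType d} (P : probability T R)
    (xi : {RV P >-> R}) :
  (\int[distribution P xi]_y y%:E = 0)%E ->
  (\int[distribution P xi]_y (y ^+ 2)%:E = 1)%E ->
  decisions z -> location_scale M P xi ->
  exists mu, same_law (law M) (loss M z) P (fun t => mu + sigma z * xi t) /\
    ('V_(law M)[loss M z] = (sigma z ^+ 2)%:E)%E.
Proof.
move=> L1 L2 dz [A [A0 Az _]]; have [[mu s] Ams Mxi] := Az z dz.
have s0 : 0 <= s by exact: (A0 _ Ams).
have V := loss_variance dz Mxi L1 L2.
have sE : sigma z = s by rewrite /sigma V /= sqrtr_sqr ger0_norm.
by exists mu; rewrite sE.
Qed.

Unset Implicit Arguments.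

Theorem theorem10 (R : realType) (alpha : R) (halpha : 0 < alpha)
    (dxi : measure_display) (Txi : measurableType dxi)
    (Pxi : probability Txi R) (xi : {RV Pxi >-> R})
    (xi_mean : ('E_Pxi[xi] = 0)%E)
    (xi_var : ('E_Pxi[(fun t => xi t ^+ 2)%R] = 1)%E)
    (fit : forall N, N.-tuple R -> probability R R)
    (measurable_fit : forall N (B : set R), measurable B ->
       measurable_fun setT (fun x : N.-tuple R => fit N x B))
    (delta : forall N, N.-tuple R -> \bar R)
    (delta_median : median_bias alpha fit delta) :
  let assumptions (M : loss_model R) (z : 'rV[R]_(dim_z M)) :=
    [/\ decisions z, location_scale M Pxi xi,
        lighter_than_gaussian (law M) (loss M z) & sigmahat_gt0 z] /\
    [/\ affine_equivariance z fit, mean_matching z fit &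
        heavy_gaussian_right_tails z fit] in
  [/\ forall N, (1 < N)%N ->
        exists c sbar : R, [/\ 0 < c, 0 < sbar &
          forall (M : loss_model R) (z : 'rV[R]_(dim_z M)),
            assumptions M z -> sbar <= sigma z ->
            (c%:E * 'V_(law M)[loss M z] <=
             expected_corrected_risk z alpha delta N - true_risk z alpha)%E],
      forall N, (1 < N)%N ->
        exists c sbar : R, [/\ 0 < c, 0 < sbar &
          forall (M : loss_model R) (z : 'rV[R]_(dim_z M)),
            assumptions M z -> subgaussian_tails z fit -> sbar <= sigma z ->
            (`| true_risk z alpha - expected_corrected_risk z alpha delta N | <=
             c%:E * 'V_(law M)[loss M z])%E] &
      forall (M : loss_model R) (z : 'rV[R]_(dim_z M)),
        assumptions M z -> subgaussian_tails z fit ->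
        {ae Pr M, forall w,
          corrected_risk z alpha delta N w @[N --> \oo] --> true_risk z alpha}].
Proof.
move=> assumptions.
set L := distribution Pxi xi.
have mxi : measurable_fun setT xi by [].
have mid : measurable_fun setT (idfun : R -> R) by exact: measurable_id.
have law_L : same_law L idfun Pxi xi by [].
have LE (f : R -> \bar R) : measurable_fun setT f ->
    (\int[L]_y f y = \int[Pxi]_t f (xi t))%E.
  by move=> mf; exact: (same_law_integral mid mxi law_L mf).
have L1 : (\int[L]_y y%:E = 0)%E.
  rewrite (LE EFin); last by apply/measurable_EFinP.
  by move: xi_mean; rewrite unlock.
have L2 : (\int[L]_y (y ^+ 2)%:E = 1)%E.
  rewrite (LE (fun y => (y ^+ 2)%:E)).
    by move: xi_var; rewrite unlock.
  by apply/measurable_EFinP; exact: measurable_funX.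
(* the constants are read off one problem of positive variance; the law of its
   standardized samples is that of every other problem *)
have lower N : (1 < N)%N -> exists c sbar : R, [/\ 0 < c, 0 < sbar &
    forall (M : loss_model R) (z : 'rV[R]_(dim_z M)),
      assumptions M z -> sbar <= sigma z ->
      (c%:E * 'V_(law M)[loss M z] <=
       expected_corrected_risk z alpha delta N - true_risk z alpha)%E].
  move=> N1; have N0 : (0 < N)%N by exact: ltnW.
  (* without such a problem the claim is void *)
  have [[M0 [z0 [as0 sig0]]]|none] := pselect (exists (M : loss_model R)
      (z : 'rV[R]_(dim_z M)), assumptions M z /\ 0 < sigma z); last first.
    exists 1, 1; split=> // M z Mz s1; exfalso; apply: none; exists M, z.
    by split=> //; exact: lt_le_trans s1.
  have [[dz0 ls0 lg0 sh0] [equi0 mm0 heavy0]] := as0.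
  have [mu0 [Mxi0 _]] := location_scale_decision L1 L2 dz0 ls0.
  have [c1 [c2 [abar [c10 c20 a0 aeh]]]] := ae_heavy_set dz0 sh0 equi0 heavy0.
  have mH := measurable_heavy_set measurable_fit (N := N) c1 c2 abar.
  have H0 : iid_law L N (~` heavy_set fit c1 c2 abar) = 0%E.
    apply/(ae_standardized_tuple dz0 sig0 Mxi0 mH).
    apply: filterS (aeh N N1) => w; rewrite (scenarios_affine z0 mu0 sig0).
    by move/heavy_set_affine; apply.
  have [c [sbar [cp sp est]]] := expected_overestimation halpha L1 L2 measurable_fit
    delta_median N1 c10 c20 a0 H0 (fun k k0 => noise_exp_square dz0 sig0 Mxi0 k0 lg0).
  exists c, sbar; split=> // M z [[dz ls lg sh] [equi mm heavy]] sz.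
  have [mu [Mxi V]] := location_scale_decision L1 L2 dz ls.
  by rewrite V -EFinM; exact: (est M z mu).
split=> //.
- move=> N N1; have N0 : (0 < N)%N by exact: ltnW.
  have [[M0 [z0 [as0 [sub0 sig0]]]]|none] := pselect (exists (M : loss_model R)
      (z : 'rV[R]_(dim_z M)), assumptions M z /\ subgaussian_tails z fit /\
      0 < sigma z); last first.
    exists 1, 1; split=> // M z Mz sub s1; exfalso; apply: none; exists M, z.
    by split=> //; split=> //; exact: lt_le_trans s1.
  have [[dz0 ls0 lg0 sh0] [equi0 mm0 heavy0]] := as0.
  have [mu0 [Mxi0 _]] := location_scale_decision L1 L2 dz0 ls0.
  have [c3 c30 aes] := ae_subgaussian_set dz0 sh0 equi0 sub0.
  have mS := measurable_subgaussian_set measurable_fit (N := N) c3.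
  have H0 : iid_law L N (~` subgaussian_set fit c3) = 0%E.
    apply/(ae_standardized_tuple dz0 sig0 Mxi0 mS).
    apply: filterS (aes N N1) => w; rewrite (scenarios_affine z0 mu0 sig0).
    by move/subgaussian_set_affine; apply.
  have [c cp est] := expected_upper_bound halpha L1 L2 measurable_fit
    delta_median N1 c30 H0.
  have [c' [sbar [c'p sp low]]] := lower N N1.
  exists c, (1 + sbar); split=> //; first by rewrite addr_gt0.
  move=> M z Mz sub sz.
  have s1 : 1 <= sigma z by apply: le_trans sz; rewrite lerDl ltW.
  have s2 : sbar <= sigma z by apply: le_trans sz; rewrite lerDr.
  have lowz := low M z Mz s2.
  have [[dz ls lg sh] [equi mm heavy]] := Mz.
  have [mu [Mxi V]] := location_scale_decision L1 L2 dz ls.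
  have upz := est M z mu _ dz Mxi equi s1.
  rewrite V -!EFinM in lowz *.
  have rfin : true_risk z alpha \is a fin_num.
    have rge := true_risk_ge dz Mxi L1 L2 halpha.
    rewrite fin_numE -ltNye (lt_le_trans (ltNyr _) rge) /=.
    by apply/eqP => roo; move: lowz; rewrite roo addeNy leNgt ltNyr.
  rewrite abse_subC// gee0_abs//.
  by apply: le_trans lowz; rewrite lee_fin mulr_ge0 ?sqr_ge0// ltW.
- move=> M z [[dz ls lg sh] [equi mm heavy]] sub.
  have [c3 c30 aes] := ae_subgaussian_set dz sh equi sub.
  exact: (ae_corrected_risk_cvg dz lg halpha delta_median c30 equi mm aes).
Qed.
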